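(* For all integers $d\geq 2$ and $n\geq d+1$, there is a labeled configuration of $n$ points $p_1,\ldots,p_n$ in $\mathbb{R}^d$ with integral pairwise Euclidean distances and the alternating order type. Consequently, its convex hull is a realization of the cyclic polytope $C(n,d)$.
   Context: For a labeled configuration $p_1,\ldots,p_n\in\mathbb{R}^d$, its order type is the sign pattern $$\chi(i_0,\ldots,i_d)=\operatorname{sgn}\det\begin{pmatrix}1&p_{i_0}^{\mathsf T}\\ \vdots&\vdots\\ 1&p_{i_d}^{\mathsf T}\end{pmatrix}$$ over all ordered $(d+1)$-tuples of distinct indices. The order type is called alternating if, after reversing the ambient orientation if necessary (i.e. possibly replacing $\chi$ by $-\chi$), $\chi(i_0,\ldots,i_d)=+1$ whenever $i_0<\cdots<i_d$. The cyclic polytope $C(n,d)$ is the combinatorial type (face lattice up to isomorphism) of the convex hull of $n$ points $\mu_d(t_i)=(t_i,t_i^2,\ldots,t_i^d)$, $t_1<\cdots<t_n$, on the moment curve in $\mathbb{R}^d$; a realization of $C(n,d)$ is a convex polytope of this combinatorial type. *)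

(* Defs.v *)
From mathcomp Require Import all_boot all_order all_algebra.
From mathcomp Require Import all_classical all_reals all_analysis.
Set Implicit Arguments.
Unset Strict Implicit.
Unset Printing Implicit Defensive.
Import Order.TTheory GRing.Theory Num.Theory.

Local Open Scope classical_set_scope.
Local Open Scope ring_scope.

Definition dot_product (R : realType) (d : nat) (x y : 'rV[R]_d) : R :=
  \sum_(i < d) x 0 i * y 0 i.

(* The norm that MathComp-Analysis puts on ['rV[R]_d] is the sup norm, hence
   an explicit Euclidean distance. *)
Definition euclidean_dist (R : realType) (d : nat) (x y : 'rV[R]_d) : R :=
  Num.sqrt (dot_product (x - y) (x - y)).

(* [row_mx 1 x : 'rV_(1 + d)] is the homogenized row (1, x_1, ..., x_d). *)
Definition order_type (R : realType) (d n : nat) (p : 'I_n -> 'rV[R]_d)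
    (i : 'I_d.+1 -> 'I_n) : R :=
  Num.sg (\det (\matrix_(k < d.+1) (row_mx 1 (p (i k)) : 'rV[R]_d.+1))).

Definition alternating_order_type (R : realType) (d n : nat)
    (p : 'I_n -> 'rV[R]_d) : Prop :=
  exists2 e : R, e = 1 \/ e = - 1 &
    forall i : 'I_d.+1 -> 'I_n,
      {homo i : j k / (j < k)%N} -> e * order_type p i = 1.

Definition conv_hull (R : realType) (d : nat) (A : set 'rV[R]_d) : set 'rV[R]_d :=
  smallest (@convex_set R 'rV[R]_d) A.

Definition is_polytope (R : realType) (d : nat) (P : set 'rV[R]_d) : Prop :=
  exists2 A : set 'rV[R]_d, finite_set A & P = conv_hull A.

(* [c = 0] yields the improper faces: [P] for [b = 0], [set0] for [b = 1]. *)
Definition is_face (R : realType) (d : nat) (P F : set 'rV[R]_d) : Prop :=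
  exists c : 'rV[R]_d, exists b : R,
    (forall x, P x -> dot_product c x <= b) /\
    F = P `&` [set x | dot_product c x = b].

(* Isomorphism of face lattices: a bijection between the faces of [P] and those
   of [Q] that preserves and reflects inclusion. *)
Definition combinatorially_equivalent (R : realType) (d : nat)
    (P Q : set 'rV[R]_d) : Prop :=
  exists2 f : set 'rV[R]_d -> set 'rV[R]_d,
    set_bij (is_face P) (is_face Q) f &
    forall F G, is_face P F -> is_face P G -> (f F `<=` f G <-> F `<=` G).

Definition moment_curve (R : realType) (d : nat) (t : R) : 'rV[R]_d :=
  \row_(j < d) t ^+ j.+1.

(* The quantification over all parameters [t] reflects that the combinatorial
   type C(n, d) does not depend on their choice. *)
Definition realizes_cyclic (R : realType) (n d : nat) (P : set 'rV[R]_d) : Prop :=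
  is_polytope P /\
  forall t : 'I_n -> R, {homo t : i j / (i < j)%N >-> i < j} ->
    combinatorially_equivalent P
      (conv_hull (range (fun i => moment_curve d (t i)))).

(* Main.v *)
Require Import Defs.
From mathcomp Require Import all_boot all_order all_algebra.
From mathcomp Require Import perm zify ring lra.
From mathcomp Require polyrcf.
From mathcomp Require Import all_classical all_reals all_analysis.
Set Implicit Arguments.
Unset Strict Implicit.
Unset Printing Implicit Defensive.
Import Order.TTheory GRing.Theory Num.Theory.

Local Open Scope classical_set_scope.
Local Open Scope ring_scope.

(** The points come from a curve all of whose chords are explicit.  Put
    f(x) = sum_j b_j sin((2j+1)x) with rational b_j.  Product-to-sum formulas
    turn f(x)^2 into sum_mu A_mu sin(mu x)^2, and if no A_mu is negative this is a
    quarter of the squared distance between two points, at parameters differing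
    by x, of the curve with coordinate pairs sqrt(A_mu) (cos(2 mu t), sin(2 mu t)).
    Hence parameters with rational cosine and sine give rational distances,
    without any condition on the coordinates themselves.  The b_j are positive and
    decrease geometrically, so that every A_mu is positive, except that A_1 can be
    made to vanish by adjusting b_1; so the number m of positive A_mu can be
    prescribed and the curve spans R^(2m) ([exists_sine_polynomial]).

    For the alternating order type, let t = 2 atan(u) with u an integer.  Up to
    positive factors, the homogeneous rows (1, p(t)) are then the values at u of
    linearly independent polynomials.  After a change of basis these are monic
    with increasing degrees, and if each u is chosen much larger than the
    previous ones, then every minor on the first columns is positive, because its
    expansion along the last row is a polynomial in the new u with positive
    leading coefficient ([exists_positive_minors]).

    This settles even dimensions.  The curve lies on a sphere about the origin, so
    inversion about one of its points maps the others into a hyperplane; distances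
    stay rational, and the order type becomes the contraction of the alternating
    order type at its first element, which is alternating in one dimension less
    ([contraction]).  This settles odd dimensions, and a homothety then clears
    denominators.

    Finally, the faces of the convex hull of a configuration correspond to the
    index sets on which a nonnegative affine functional vanishes, and for an
    alternating configuration this family of sets depends on n and d only
    ([supporting_alternating]).  As points on the moment curve are alternating by
    the Vandermonde determinant, the hull is a cyclic polytope. *)

(** * Choosing points where all minors are positive *)

(** Pick a member of maximal degree, reduce the others below that degree with
    it, and recurse: Gaussian elimination on leading coefficients. *)
Lemma exists_echelon (R : fieldType) (D : nat) (P : 'I_D -> {poly R}) :
  (forall c : 'I_D -> R, \sum_i c i *: P i = 0 -> forall i, c i = 0) ->
  exists L : 'M[R]_D, exists2 Q : 'I_D -> {poly R},
    forall i, Q i = \sum_j L i j *: P j &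
    (forall i, Q i \is monic) /\
    (forall i j : 'I_D, (i < j)%N -> (size (Q i) < size (Q j))%N).
Proof.
elim: D P => [|D IH] P indep.
  by exists 0, (fun=> 0) => [[]|] //; split=> [[]|[]].
pose j0 := [arg max_(i > ord0) size (P i)]%N.
have leP i : (size (P i) <= size (P j0))%N.
  by rewrite /j0; case: arg_maxnP => // j _; apply.
have P0 : P j0 != 0.
  apply/eqP => P0; have H : \sum_i (i == j0)%:R *: P i = 0.
    rewrite (bigD1 j0) //= eqxx P0 scaler0 add0r big1 // => i /negPf ->.
    by rewrite scale0r.
  by have /eqP := indep (fun i => (i == j0)%:R) H j0; rewrite eqxx oner_eq0.
set s := size (P j0) in leP.
have s0 : (0 < s)%N by rewrite size_poly_gt0.
have l0 : lead_coef (P j0) != 0 by rewrite lead_coef_eq0.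
pose r i := (P (lift j0 i))`_s.-1 / lead_coef (P j0).
pose P' i := P (lift j0 i) - r i *: P j0.
have sP' i : (size (P' i) < s)%N.
  rewrite -(prednK s0) ltnS; apply/leq_sizeP => j.
  rewrite leq_eqVlt => /predU1P[<-|]; rewrite !coefE.
    by rewrite /r /lead_coef -/s divfK ?subrr.
  rewrite prednK // => sj.
  by rewrite !nth_default ?mulr0 ?subr0 // (leq_trans (leP _)).
have splitP' (c : 'I_D -> R) :
    \sum_i c i *: P' i = \sum_i (c i *: P (lift j0 i)) - (\sum_i c i * r i) *: P j0.
  rewrite scaler_suml -sumrB; apply: eq_bigr => i _.
  by rewrite /P' scalerBr scalerA.
have [|L' [Q' QE [Qmon Qlt]]] := IH P'.
  move=> c c0 i.
  pose c' k := if unlift j0 k is Some i then c i else - \sum_i c i * r i.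
  have H : \sum_k c' k *: P k = 0.
    rewrite (bigD1_ord j0) //= {1}/c' unlift_none.
    under eq_bigr => k _ do rewrite /c' liftK.
    by rewrite -[RHS]c0 splitP' scaleNr addrC.
  have := indep _ H (lift j0 i).
  by rewrite /c' liftK.
pose L := \matrix_(i < D.+1, k < D.+1)
  if unlift ord_max i is Some i' then
    if unlift j0 k is Some k' then L' i' k' else - \sum_j L' i' j * r j
  else (k == j0)%:R / lead_coef (P j0).
pose Q i := if unlift ord_max i is Some i' then Q' i'
  else (lead_coef (P j0))^-1 *: P j0.
exists L, Q.
  move=> i; rewrite /Q; case: (unliftP ord_max i) => [i'|] ->.
    rewrite QE splitP' (bigD1_ord j0) //= [LHS]addrC; congr (_ + _).
      by rewrite /L mxE liftK unlift_none scaleNr.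
    by apply: eq_bigr => k _; rewrite /L mxE !liftK.
  rewrite (bigD1 j0) //= big1 => [|k /negPf kj]; last first.
    by rewrite /L mxE unlift_none kj mul0r scale0r.
  by rewrite /L mxE unlift_none eqxx mul1r addr0.
have szQ' i : (size (Q' i) < s)%N.
  rewrite QE; apply: (leq_ltn_trans (size_sum _ _ _)).
  rewrite -(prednK s0) ltnS; apply/bigmax_leqP => k _.
  by rewrite -ltnS prednK // (leq_ltn_trans (size_scale_leq _ _)).
split=> [i|i j].
  rewrite /Q; case: (unliftP ord_max i) => [i'|] _ //.
  by rewrite monicE lead_coefZ mulVf.
rewrite /Q; case: (unliftP ord_max i) => [i'|] ->; last first.
  by rewrite ltnNge leq_ord.
case: (unliftP ord_max j) => [j'|] -> => [|_].
  by rewrite !lift_max; apply: Qlt.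
by rewrite size_scale ?invr_eq0.
Qed.

(** The minors with fewer columns than D are there for the induction: the minor
    with k + 1 rows grows, as its last argument tends to infinity, like the minor
    formed by its first k rows and columns times a monic polynomial. *)
Lemma exists_positive_minors (R : realType) (D : nat) (Q : nat -> {poly R}) :
  (forall b, (b < D)%N -> Q b \is monic) ->
  (forall a b, (a < b < D)%N -> (size (Q a) < size (Q b))%N) ->
  forall N, exists t : nat -> nat, forall k (i : 'I_k -> nat),
    (k <= D)%N -> (forall a, i a < N)%N -> {homo i : a b / (a < b)%N} ->
    0 < \det (\matrix_(a < k, b < k) (Q b).[(t (i a))%:R]).
Proof.
move=> Qmon Qlt; elim=> [|N [t IH]].
  exists id => -[|k] i _ iN _; first by rewrite det_mx00.
  by have := iN ord0; rewrite ltn0.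
(* Only the last row depends on the new value T, hence its cofactors do not. *)
pose M k (i : 'I_k -> nat) T : 'M[R]_k.+1 := \matrix_(a < k.+1, b < k.+1)
  (Q b).[(if unlift ord_max a is Some a' then t (i a') else T)%:R].
have cofM k (i : 'I_k -> nat) T b :
    cofactor (M k i T) ord_max b = cofactor (M k i 0%N) ord_max b.
  congr (_ * \det _); apply/matrixP => a c; rewrite !mxE.
  by rewrite liftK.
have cof_max k (i : 'I_k -> nat) :
    cofactor (M k i 0%N) ord_max ord_max
      = \det (\matrix_(a < k, b < k) (Q b).[(t (i a))%:R]).
  rewrite /cofactor addnn -signr_odd odd_double mul1r; congr (\det _).
  by apply/matrixP => a b; rewrite !mxE liftK lift_max.
pose p k (i : 'I_k -> nat) := \sum_b cofactor (M k i 0%N) ord_max b *: Q b.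
have detM k (i : 'I_k -> nat) T : \det (M k i T) = (p k i).[T%:R].
  rewrite (expand_det_row _ ord_max) horner_sum; apply: eq_bigr => b _.
  by rewrite cofM hornerZ mulrC mxE unlift_none.
have lead_p k (i : 'I_k -> nat) : (k < D)%N -> (forall a, i a < N)%N ->
    {homo i : a b / (a < b)%N} -> 0 < lead_coef (p k i).
  move=> kD iN ih; rewrite /p big_ord_recr /=.
  have c0 : 0 < cofactor (M k i 0%N) ord_max ord_max.
    by rewrite cof_max; apply: IH => //; apply: ltnW.
  rewrite lead_coefDr; first by rewrite lead_coefZ (monicP (Qmon _ kD)) mulr1.
  rewrite size_scale ?gt_eqF //; apply: (leq_ltn_trans (size_sum _ _ _)).
  have Qk0 : (0 < size (Q k))%N by rewrite size_poly_gt0 monic_neq0 // Qmon.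
  rewrite -(prednK Qk0) ltnS; apply/bigmax_leqP => b _.
  by rewrite -ltnS prednK // (leq_ltn_trans (size_scale_leq _ _)) // Qlt //= ltn_ord.
have : \forall T \near \oo, forall (k : 'I_D) (i : {ffun 'I_k -> 'I_N}),
    {homo i : a b / (a < b)%N} -> 0 < (p k (fun a => i a)).[T%:R].
  apply: filter_forall => k; apply: filter_forall => i.
  have [ih|nih] := pselect {homo i : a b / (a < b)%N}; last first.
    by apply: nearW => T.
  have lp := lead_p k (fun a => i a) (ltn_ord k) (fun a => ltn_ord _) ih.
  have [x px] := polyrcf.poly_pinfty_gt_lc lp.
  exists (Num.bound `|x|) => // T /= xT _; apply: (lt_le_trans lp); apply: px.
  apply: (le_trans (ler_norm _)).
  by apply/ltW/(lt_le_trans (archi_boundP (normr_ge0 _))); rewrite ler_nat.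
move=> /filter_ex [T TP].
exists (fun x => if (x < N)%N then t x else T) => -[|k] i kD iN ih.
  by rewrite det_mx00.
have iltN a : (i (lift ord_max a) < N)%N.
  rewrite -ltnS; apply: (leq_trans _ (iN ord_max)); rewrite ltnS; apply: ih.
  by rewrite lift_max ltn_ord.
have [maxN|maxN] := ltnP (i ord_max) N.
  have -> : \matrix_(a < k.+1, b < k.+1)
      (Q b).[(if (i a < N)%N then t (i a) else T)%:R] =
      \matrix_(a < k.+1, b < k.+1) (Q b).[(t (i a))%:R].
    apply/matrixP => a b; rewrite !mxE.
    by case: (unliftP ord_max a) => [a'|] ->; rewrite ?iltN ?maxN.
  apply: IH => // a.
  by case: (unliftP ord_max a) => [a'|] ->; rewrite ?iltN ?maxN.
have := TP (Ordinal kD) [ffun a => Ordinal (iltN a)].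
rewrite -detM /=.
set A := \det _; set B := \det _; suff -> : A = B.
  apply=> a b ab; rewrite !ffunE /=; apply: ih.
  by rewrite !lift_max.
congr (\det _); apply/matrixP => a b; rewrite !mxE.
case: (unliftP ord_max a) => [a'|] ->; first by rewrite ffunE /= iltN.
by rewrite ltnNge maxN.
Qed.

(** * Trigonometric functions as polynomials in the half-angle tangent *)

(** Real and imaginary parts of (1 + iX)^(2k). *)
Fixpoint half_angle_poly (R : nzRingType) (k : nat) : {poly R} * {poly R} :=
  if k is k'.+1 then
    let: (c, s) := half_angle_poly R k' in
    ((1 - 'X^2) * c - 2%:R *: 'X * s, 2%:R *: 'X * c + (1 - 'X^2) * s)
  else (1, 0).

Definition frequency (kappa j : nat) : nat := (uphalf j + kappa).*2.

(** Column 0 is the constant function; columns 2i + 1 and 2i + 2 are the cosine and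
    the sine of frequency 2(i + 1 + kappa). *)
Definition trig_column (R : realType) (kappa j : nat) (th : R) : R :=
  if j == 0%N then 1
  else if odd j then cos ((frequency kappa j)%:R * th)
  else sin ((frequency kappa j)%:R * th).

(** [trig_column kappa j] in the variable tan(th/2), multiplied by a power of
    1 + X^2 that clears all denominators and is the same for every column j <= 2m. *)
Definition trig_poly (R : nzRingType) (kappa m j : nat) : {poly R} :=
  if j == 0%N then (1 + 'X^2) ^+ (m + kappa).*2
  else (1 + 'X^2) ^+ ((m + kappa).*2 - frequency kappa j) *
    (let: (c, s) := half_angle_poly R (frequency kappa j) in
     if odd j then c else s).

Section TrigPolynomials.
Variable R : realType.
Implicit Types (t : R).

Lemma cos_sin_double_atan t :
  cos (2%:R * atan t) = (1 - t ^+ 2) / (1 + t ^+ 2) /\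
  sin (2%:R * atan t) = 2%:R * t / (1 + t ^+ 2).
Proof.
have pos : 0 < 1 + t ^+ 2 by rewrite ltr_pwDl ?sqr_ge0.
have c2 : cos (atan t) ^+ 2 = (1 + t ^+ 2)^-1.
  by rewrite cos_atan exprVn sqr_sqrtr // ltW.
have c0 : cos (atan t) != 0 by rewrite cos_atan invr_neq0 ?gt_eqF ?sqrtr_gt0.
have sE : sin (atan t) = t * cos (atan t).
  by rewrite -[X in X * _]atanK /tan divfK.
rewrite mulr_natl mulr2n cosD sinD sE.
have -> : cos (atan t) * cos (atan t) - t * cos (atan t) * (t * cos (atan t))
  = (1 - t ^+ 2) * cos (atan t) ^+ 2 by ring.
have -> : t * cos (atan t) * cos (atan t) + cos (atan t) * (t * cos (atan t))
  = 2%:R * t * cos (atan t) ^+ 2 by ring.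
by rewrite c2.
Qed.

Lemma horner_half_angle_poly t k :
  (half_angle_poly R k).1.[t]
    = (1 + t ^+ 2) ^+ k * cos (k%:R * (2%:R * atan t)) /\
  (half_angle_poly R k).2.[t]
    = (1 + t ^+ 2) ^+ k * sin (k%:R * (2%:R * atan t)).
Proof.
have pos : 1 + t ^+ 2 != 0 by rewrite gt_eqF // ltr_pwDl ?sqr_ge0.
elim: k => [|k [IHc IHs]].
  by rewrite /= !mul0r cos0 sin0 !hornerE.
have [cE sE] := cos_sin_double_atan t.
rewrite -[k.+1%:R]natr1 [(_ + 1) * _]mulrDl mul1r cosD sinD cE sE exprS.
rewrite /=; case: (half_angle_poly R k) IHc IHs => c s /=.
set u := cos (k%:R * _); set v := sin (k%:R * _); move: u v => u v IHc IHs.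
rewrite !(hornerD, hornerN, hornerM, hornerZ, hornerX, hornerXn).
by rewrite -[1 : {poly R}]/(1%:P) !hornerC IHc IHs; split; field.
Qed.

(** Modulo 1 + X^2 the variable is a square root of -1, and (1 + iX)^2 becomes
    2 (1 + iX). *)
Lemma half_angle_poly_mod k : exists u v : {poly R},
  (half_angle_poly R k.+1).1 = (2 ^ k.*2.+1)%:R + (1 + 'X^2) * u /\
  (half_angle_poly R k.+1).2 = (2 ^ k.*2.+1)%:R * 'X + (1 + 'X^2) * v.
Proof.
elim: k => [|k [u [v []]]].
  exists (-1), 0; rewrite /= expn1; split; last by rewrite -mul_polyC polyC_natr; ring.
  by rewrite -mul_polyC; ring.
rewrite -[half_angle_poly R k.+2]/(let: (c, s) := half_angle_poly R k.+1 in
    ((1 - 'X^2) * c - 2%:R *: 'X * s, 2%:R *: 'X * c + (1 - 'X^2) * s)).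
case: (half_angle_poly R k.+1) => c s /= -> ->.
rewrite -!mul_polyC polyC_natr doubleS !expnS !natrM.
set al := (2 ^ k.*2)%:R.
exists ((1 - 'X^2) * u - 2%:R * 'X * v - 6%:R * al).
exists (2%:R * 'X * u + (1 - 'X^2) * v - 2%:R * al * 'X).
by split; ring.
Qed.

End TrigPolynomials.

(** * Rational parameters with alternating determinants *)

Section Rational.
Variable R : realType.
Implicit Types x y : R.

Lemma rational_nat n : rational (n%:R : R).
Proof. by exists n%:R => //; rewrite rmorph_nat. Qed.

Lemma rationalD x y : rational x -> rational y -> rational (x + y).
Proof. by move=> [p _ <-] [q _ <-]; exists (p + q) => //; rewrite rmorphD. Qed.

Lemma rationalN x : rational x -> rational (- x).
Proof. by move=> [p _ <-]; exists (- p) => //; rewrite rmorphN. Qed.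

Lemma rationalM x y : rational x -> rational y -> rational (x * y).
Proof. by move=> [p _ <-] [q _ <-]; exists (p * q) => //; rewrite rmorphM. Qed.

Lemma rationalV x : rational x -> rational x^-1.
Proof. by move=> [p _ <-]; exists p^-1 => //; rewrite fmorphV. Qed.

Lemma rational_norm x : rational x -> rational `|x|.
Proof. by move=> [p _ <-]; exists `|p| => //; rewrite ratr_norm. Qed.

Lemma rational_sum (I : Type) (s : seq I) (F : I -> R) :
  (forall i, rational (F i)) -> rational (\sum_(i <- s) F i).
Proof.
move=> FQ; elim/big_ind: _ => // [|x y]; last exact: rationalD.
exact: (rational_nat 0).
Qed.

End Rational.

Lemma size_1addX2 (R : nzRingType) : size (1 + 'X^2 : {poly R}) = 3%N.
Proof. by rewrite addrC size_polyDl ?size_polyXn ?size_poly1. Qed.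

Lemma linear_multiple_1addX2 (R : idomainType) (a b : R) (p : {poly R}) :
  a%:P + b *: 'X = (1 + 'X^2) * p -> a = 0 /\ b = 0.
Proof.
have [-> E|p0 E] := eqVneq p 0.
  have Ei i : (a%:P + b *: 'X : {poly R})`_i = 0 by rewrite E mulr0 coef0.
  move: (Ei 0%N) (Ei 1%N); rewrite !coefE /=.
  by rewrite mulr0 addr0 mulr1 add0r.
have X2n0 : 1 + 'X^2 != 0 :> {poly R} by rewrite -size_poly_eq0 size_1addX2.
have szE : size (a%:P + b *: 'X) = (size p).+2.
  by rewrite E size_mul // size_1addX2.
have : (size (a%:P + b *: 'X)%R <= 2)%N.
  rewrite (leq_trans (size_polyD _ _)) // geq_max.
  rewrite (leq_trans (size_polyC_leq1 _)) //=.
  by rewrite (leq_trans (size_scale_leq _ _)) ?size_polyX.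
by rewrite szE; move: p0; rewrite -size_poly_gt0; case: (size p).
Qed.

Lemma frequency_le kappa m j :
  (j < m.*2.+1)%N -> (frequency kappa j <= (m + kappa).*2)%N.
Proof. by rewrite ltnS -leq_uphalf_double leq_double leq_add2r. Qed.

Section Independence.
Variable R : realType.

(** Raising m by one only multiplies the old columns by (1 + X^2)^2, while the two
    new ones are coprime to 1 + X^2: this drives the proof of independence. *)
Lemma trig_polyS kappa m j : (j < m.*2.+1)%N ->
  trig_poly R kappa m.+1 j = (1 + 'X^2) ^+ 2 * trig_poly R kappa m j.
Proof.
move=> jm; rewrite /trig_poly; case: eqP => _; first by rewrite -exprD addSn doubleS.
rewrite mulrA -exprD; congr (_ ^+ _ * _).
by rewrite addSn doubleS -addn2 -addnBAC ?frequency_le // addnC.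
Qed.

Lemma trig_poly_top kappa m :
  trig_poly R kappa m.+1 m.*2.+1 = (half_angle_poly R (m.+1 + kappa).*2).1 /\
  trig_poly R kappa m.+1 m.*2.+2 = (half_angle_poly R (m.+1 + kappa).*2).2.
Proof.
rewrite /trig_poly /= !negbK !odd_double /= /frequency.
rewrite /= doubleK uphalf_double.
by rewrite subnn expr0 !mul1r; case: (half_angle_poly R _).
Qed.

(** Reducing a linear relation modulo 1 + X^2 leaves c + c'X times a nonzero
    constant, where c and c' are the coefficients of the two columns of highest
    frequency.  So both vanish and the remaining relation is divisible by
    (1 + X^2)^2. *)
Lemma trig_poly_indep kappa m (c : nat -> R) :
  \sum_(j < m.*2.+1) c j *: trig_poly R kappa m j = 0 ->
  forall j, (j < m.*2.+1)%N -> c j = 0.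
Proof.
have X2n0 : 1 + 'X^2 != 0 :> {poly R} by rewrite -size_poly_eq0 size_1addX2.
elim: m => [|m IH].
  rewrite big_ord_recl big_ord0 addr0 => /eqP.
  rewrite scaler_eq0 expf_eq0 (negPf X2n0) andbF orbF => /eqP c0.
  by case.
rewrite doubleS 2!big_ord_recr /=.
have [-> ->] := trig_poly_top kappa m.
under eq_bigr => j _ do rewrite trig_polyS // scalerAr.
rewrite -mulr_sumr; set p := (X in _ * X).
have [u [v [-> ->]]] := half_angle_poly_mod R (m + kappa).*2.+1.
set al := (2 ^ _)%N => E.
have al0 : (al%:R : R) != 0 by rewrite pnatr_eq0 expn_eq0.
have [] := @linear_multiple_1addX2 R (c m.*2.+1 * al%:R) (c m.*2.+2 * al%:R)
  (- ((1 + 'X^2) * p + c m.*2.+1 *: u + c m.*2.+2 *: v)).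
  apply/eqP; rewrite -subr_eq0; apply/eqP; rewrite -[RHS]E.
  rewrite -!mul_polyC !polyCM !polyC_natr.
  move: (c _)%:P (c _.+2)%:P (al%:R : {poly R}) (p : {poly R}) => c1 c2 A q.
  by ring.
move=> /eqP; rewrite mulf_eq0 (negPf al0) orbF => /eqP c1.
move=> /eqP; rewrite mulf_eq0 (negPf al0) orbF => /eqP c2.
move: E; rewrite c1 c2 !scale0r !addr0 => /eqP.
rewrite mulf_eq0 expf_eq0 (negPf X2n0) andbF /= => /eqP /IH {}IH j.
rewrite !ltnS leq_eqVlt => /predU1P[->//|].
by rewrite ltnS leq_eqVlt => /predU1P[->//|] /IH.
Qed.

Lemma horner_trig_poly kappa m j (t : R) : (j < m.*2.+1)%N ->
  (trig_poly R kappa m j).[t] =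
    (1 + t ^+ 2) ^+ (m + kappa).*2 * trig_column kappa j (2%:R * atan t).
Proof.
move=> jm; have X2E : (1 + 'X^2).[t] = 1 + t ^+ 2 by rewrite !hornerE.
rewrite /trig_poly /trig_column; case: eqP => _; first by rewrite mulr1 horner_exp X2E.
have [cE sE] := horner_half_angle_poly t (frequency kappa j).
have le : (frequency kappa j <= (m + kappa).*2)%N by apply: frequency_le.
rewrite hornerM horner_exp X2E -[in RHS](subnK le) exprD -mulrA; congr (_ * _).
by case: (half_angle_poly R _) cE sE => /= ? ? cE sE; case: (odd j).
Qed.

Lemma rational_cos_sin_double_atan (t : nat) :
  rational (cos (2%:R * atan (t%:R : R))) /\ rational (sin (2%:R * atan (t%:R : R))).
Proof.
have [-> ->] := cos_sin_double_atan (t%:R : R).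
by split; rewrite ?expr2; do ?[exact: rational_nat | exact: (rational_nat R 1) |
  apply: rationalM | apply: rationalD | apply: rationalN | apply: rationalV].
Qed.

(** The sign e is that of the determinant of the change of basis to echelon
    form. *)
Lemma exists_alternating_angles kappa m N : exists th : 'I_N -> R,
  (forall i, rational (cos (th i)) /\ rational (sin (th i))) /\
  exists2 e : R, e = 1 \/ e = -1 & forall i : 'I_m.*2.+1 -> 'I_N,
    {homo i : a b / (a < b)%N} ->
    0 < e * \det (\matrix_(a < m.*2.+1, b < m.*2.+1) trig_column kappa b (th (i a))).
Proof.
have [|L [Q QE [Qmon Qlt]]] :=
    @exists_echelon R m.*2.+1 (fun j => trig_poly R kappa m j).
  move=> c H; pose c' j := c (inord j).
  have cE j : c j = c' j by rewrite /c' inord_val.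
  move=> j; rewrite cE; apply: (@trig_poly_indep kappa m c') => //.
  by rewrite -[RHS]H; apply: eq_bigr => k _; rewrite cE.
have [||t tP] := @exists_positive_minors R m.*2.+1 (fun b => Q (inord b)) _ _ N.
- by move=> b _; apply: Qmon.
- move=> a b /andP[ab bD]; apply: Qlt.
  by rewrite !inordK // (ltn_trans ab).
exists (fun i => 2%:R * atan (t i)%:R); split.
  by move=> i; apply: rational_cos_sin_double_atan.
exists (if 0 < \det L then 1 else -1); first by case: ifP; [left|right].
move=> i ih; set A := \matrix_(_, _) _.
have := tP _ (fun a => i a) (leqnn _) (fun a => ltn_ord _) ih.
pose w : 'rV[R]_m.*2.+1 := \row_a (1 + (t (i a))%:R ^+ 2) ^+ (m + kappa).*2.
have -> : \matrix_(a < m.*2.+1, b < m.*2.+1) (Q (inord b)).[(t (i a))%:R]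
    = diag_mx w *m A *m L^T.
  apply/matrixP => a b; rewrite !mxE inord_val QE horner_sum.
  apply: eq_bigr => j _; rewrite hornerZ horner_trig_poly // mul_diag_mx !mxE.
  by rewrite mulrC.
rewrite !det_mulmx det_tr det_diag.
have w0 : 0 < \prod_a w 0 a.
  by apply: prodr_gt0 => a _; rewrite mxE exprn_gt0 // ltr_pwDl ?sqr_ge0.
rewrite -mulrA pmulr_rgt0 //; case: ifP => [L0|/negbT]; first by rewrite mul1r pmulr_lgt0.
rewrite -leNgt le_eqVlt => /predU1P[->|L0]; first by rewrite mulr0 ltxx.
by rewrite nmulr_lgt0 // mulN1r oppr_gt0.
Qed.

End Independence.

(** * Sine polynomials whose square is a sum of squared sines *)

(** The coefficient A_mu of sin(mu d)^2 in the square of the sine polynomial with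
    K coefficients b_j; see [sinM_odd] for the two contributions of each pair. *)
Definition square_coef (R : pzRingType) (K : nat) (b : nat -> R) (mu : nat) : R :=
  \sum_(j < K) \sum_(k < K) b j * b k *
    (((j + k).+1 == mu)%:R - ((j - k) + (k - j) == mu)%N%:R).

Section SinePolynomials.
Variable R : realType.
Implicit Types (b : nat -> R) (d : R).

Lemma sum_delta (n N : nat) (F : nat -> R) : (n < N)%N ->
  \sum_(i < N) (n == i)%:R * F i = F n.
Proof.
move=> nN; rewrite (bigD1 (Ordinal nN)) //= eqxx mul1r big1 ?addr0 // => i.
by rewrite -val_eqE /= eq_sym => /negPf ->; rewrite mul0r.
Qed.

Lemma sinM_odd (j k : nat) d :
  sin (j.*2.+1%:R * d) * sin (k.*2.+1%:R * d) =
  sin ((j + k).+1%:R * d) ^+ 2 - sin (((j - k) + (k - j))%N%:R * d) ^+ 2.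
Proof.
wlog kj : j k / (k <= j)%N.
  move=> H; have [/H //|/ltnW /H] := leqP k j.
  by rewrite mulrC => ->; rewrite [(k + j)%N]addnC [(k - j + _)%N]addnC.
have -> : ((j - k) + (k - j))%N = (j - k)%N by lia.
rewrite natrB //; set x := (j + k).+1%:R * d; set y := (_ - _) * d.
have -> : j.*2.+1%:R * d = x + y.
  by rewrite /x /y -mulrDl; congr (_ * _); rewrite -natrB // -natrD; congr (_%:R); lia.
have -> : k.*2.+1%:R * d = x - y.
  rewrite /x /y -mulrBl; congr (_ * _); rewrite -natrB // -natrB; last by lia.
  by congr (_%:R); lia.
rewrite sinD sinB.
have := cos2Dsin2 x; have := cos2Dsin2 y.
move: (cos x) (sin x) (cos y) (sin y) => cx sx cy sy Hy Hx.
have Ex : cx ^+ 2 = 1 - sx ^+ 2 by rewrite -Hx addrK.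
have Ey : cy ^+ 2 = 1 - sy ^+ 2 by rewrite -Hy addrK.
have -> : (sx * cy + cx * sy) * (sx * cy - cx * sy)
  = sx ^+ 2 * cy ^+ 2 - cx ^+ 2 * sy ^+ 2 by ring.
by rewrite Ex Ey; ring.
Qed.

Lemma sine_polynomial_square K b d :
  (\sum_(j < K) b j * sin (j.*2.+1%:R * d)) ^+ 2 =
  \sum_(mu < K.*2) square_coef K b mu * sin (mu%:R * d) ^+ 2.
Proof.
rewrite expr2 big_distrlr /=.
under [RHS]eq_bigr => mu _.
  rewrite /square_coef mulr_suml.
  under eq_bigr => j _ do rewrite mulr_suml.
  over.
rewrite [RHS]exchange_big; apply: eq_bigr => j _.
rewrite [RHS]exchange_big; apply: eq_bigr => k _ /=.
under [RHS]eq_bigr => mu _ do rewrite -mulrA mulrBl.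
rewrite -mulr_sumr sumrB mulrACA sinM_odd; congr (_ * (_ - _)).
  rewrite (@sum_delta _ _ (fun mu => sin (mu%:R * d) ^+ 2)) //.
  by have := ltn_ord j; have := ltn_ord k; lia.
rewrite (@sum_delta _ _ (fun mu => sin (mu%:R * d) ^+ 2)) //.
by have := ltn_ord j; have := ltn_ord k; lia.
Qed.

Lemma square_coefE K b mu : (0 < mu)%N ->
  square_coef K b mu = \sum_(j < K) \sum_(k < K) ((j + k).+1 == mu)%:R * (b j * b k)
    - 2%:R * \sum_(j < K) \sum_(k < K) (k == j + mu :> nat)%N%:R * (b j * b k).
Proof.
move=> mu0; rewrite mulr_natl mulr2n.
rewrite [X in _ - (_ + X)]exchange_big -!big_split /= -sumrB.
apply: eq_bigr => j _; rewrite -big_split -sumrB; apply: eq_bigr => k _ /=.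
rewrite mulrBr mulrC; congr (_ - _).
have -> : ((j - k) + (k - j) == mu)%N = (k == j + mu :> nat)%N || (j == k + mu :> nat)%N.
  by lia.
case: eqP => [->|_] /=; last by rewrite mul0r add0r mulrC [b k * _]mulrC.
have -> : (j == j + mu + mu :> nat)%N = false by lia.
by rewrite mul0r addr0 mulrC.
Qed.

Lemma sum_geometric_third n : \sum_(j < n) (3%:R^-1 : R) ^+ j.+1 < 2%:R^-1.
Proof.
suff -> : \sum_(j < n) (3%:R^-1 : R) ^+ j.+1 = 2%:R^-1 * (1 - (3%:R^-1) ^+ n).
  by rewrite gtr_pMr ?invr_gt0 ?ltr0n // gtrBl exprn_gt0 // invr_gt0 ltr0n.
elim: n => [|n IH]; first by rewrite big_ord0 expr0 subrr mulr0.
by rewrite big_ord_recr /= IH exprS; field.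
Qed.

(** For mu >= K there are no negative contributions.  For mu < K the term
    b_0 b_(mu-1) alone outweighs all of them, as their sum is less than
    2 b_(mu-1) (1/3 + 1/9 + ...). *)
Lemma square_coef_gt0 K b mu : (0 < mu < K.*2)%N -> (forall j, 0 < b j <= 1) ->
  b 0%N = 1 -> (forall j, b (j + mu)%N <= b mu.-1 * 3%:R^-1 ^+ j.+1) ->
  0 < square_coef K b mu.
Proof.
move=> /andP[mu0 muK] b01 b0 bdec; rewrite square_coefE // subr_gt0.
have bb0 j k : 0 < b j * b k.
  by rewrite mulr_gt0 //; case/andP: (b01 j); case/andP: (b01 k).
have term0 (x : bool) j k : 0 <= x%:R * (b j * b k) by rewrite mulr_ge0 ?ler0n // ltW.
set P := \sum_(j < K) \sum_(k < K) (_ == mu)%:R * _.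
have leP (j k : 'I_K) : (j + k).+1 = mu -> b j * b k <= P.
  move=> jk; rewrite /P (bigD1 j) //= (bigD1 k) //= jk eqxx mul1r -addrA lerDl.
  by rewrite addr_ge0 // ?sumr_ge0 // => *; rewrite ?sumr_ge0.
have [muK'|muK'] := ltnP mu K; last first.
  rewrite big1 ?mulr0 => [|j _]; last first.
    rewrite big1 // => k _; have -> : (k == j + mu :> nat)%N = false.
      by have := ltn_ord k; lia.
    by rewrite mul0r.
  have K1 : (K.-1 < K)%N by lia.
  have K2 : (mu - K < K)%N by lia.
  have KE : (K.-1 + (mu - K)).+1 = mu by lia.
  exact: lt_le_trans (bb0 _ _) (leP (Ordinal K1) (Ordinal K2) KE).
have K1 : (0 < K)%N by lia.
have K2 : (mu.-1 < K)%N by lia.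
have := leP (Ordinal K1) (Ordinal K2) (prednK mu0).
rewrite /= b0 mul1r; apply: lt_le_trans.
rewrite -ltr_pdivlMl ?ltr0n //.
have bmu0 : 0 < b mu.-1 by case/andP: (b01 mu.-1).
apply: (@le_lt_trans _ _ (b mu.-1 * \sum_(j < K) 3%:R^-1 ^+ j.+1)); last first.
  by rewrite [X in _ < X]mulrC ltr_pM2l // sum_geometric_third.
rewrite mulr_sumr; apply: ler_sum => j _.
apply: le_trans (bdec j).
have [jmu|jmu] := ltnP (j + mu) K; last first.
  rewrite big1 ?ltW //; first by case/andP: (b01 (j + mu)%N).
  move=> k _; have -> : (k == j + mu :> nat)%N = false by have := ltn_ord k; lia.
  by rewrite mul0r.
under eq_bigr => k _ do rewrite eq_sym.
rewrite (@sum_delta _ _ (fun k => b j * b k)) // ger_pMl; first by case/andP: (b01 j).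
by case/andP: (b01 (j + mu)%N).
Qed.

(** Powers of 1/3 with a free coefficient at index 1, which serves to tune A_1. *)
Definition base_coef (x : R) (j : nat) : R := if j == 1%N then x else 3%:R^-1 ^+ j.

Lemma expr_third_01 j : 0 < (3%:R^-1 : R) ^+ j <= 1.
Proof.
rewrite exprn_gt0 ?invr_gt0 ?ltr0n //= exprn_ile1 ?invr_ge0 ?ler0n //.
by rewrite invf_le1 ?ltr0n // ler1n.
Qed.

Lemma base_coef_01 x : 3%:R^-1 <= x <= 2%:R^-1 -> forall j, 0 < base_coef x j <= 1.
Proof.
move=> xI j; rewrite /base_coef; case: eqP => _; last exact: expr_third_01.
by lra.
Qed.

Lemma base_coef_decr x mu : 3%:R^-1 <= x -> (1 < mu)%N \/ (mu = 1%N /\ x = 3%:R^-1) ->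
  forall j, base_coef x (j + mu)%N <= base_coef x mu.-1 * 3%:R^-1 ^+ j.+1.
Proof.
move=> x3 [mu1|[-> ->]] j; last first.
  by rewrite /base_coef /= expr0 mul1r addn1; case: eqP => // -[->]; rewrite expr1.
case: mu mu1 => [//|[//|mu]] _; rewrite /base_coef /=.
have -> : (j + mu.+2 == 1)%N = false by lia.
have E : (3%:R^-1 : R) ^+ (j + mu.+2) = 3%:R^-1 ^+ mu.+1 * 3%:R^-1 ^+ j.+1.
  by rewrite -exprD; congr (_ ^+ _); lia.
rewrite E ler_pM2r; last by case/andP: (expr_third_01 j.+1).
by case: eqP => // -[->]; rewrite expr1.
Qed.

Lemma rational_base_coef x : rational x -> forall j, rational (base_coef x j).
Proof.
move=> xQ j; rewrite /base_coef; case: eqP => // _; rewrite exprVn -natrX.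
exact/rationalV/rational_nat.
Qed.

(** A_1 is an affine function of b_1, and its root is rational; the other terms
    are small enough for the root to stay in the range where the geometric decay
    of [base_coef_decr] persists. *)
Lemma exists_killing_coef K : exists x : R,
  [/\ rational x, 3%:R^-1 <= x <= 2%:R^-1 & square_coef K.+2 (base_coef x) 1 = 0].
Proof.
have coef1 x : square_coef K.+2 (base_coef x) 1
    = 1 - 2%:R * \sum_(j < K.+1) base_coef x j * base_coef x j.+1.
  rewrite square_coefE //; congr (_ - _ * _).
    rewrite big_ord_recl [X in X + _]big_ord_recl.
    rewrite [X in _ + X + _]big1 => [|k _]; last by rewrite mul0r.
    rewrite [X in _ + X]big1 => [|j _]; last by rewrite big1 // => k _; rewrite mul0r.
    by rewrite !addr0 mul1r /base_coef /= expr0 mulr1.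
  rewrite big_ord_recr /= [X in _ + X]big1 ?addr0 => [|k _]; last first.
    have -> : (k == K.+1 + 1 :> nat)%N = false by have := ltn_ord k; lia.
    by rewrite mul0r.
  apply: eq_bigr => j _; under eq_bigr => k _ do rewrite eq_sym addn1.
  by rewrite (@sum_delta _ _ (fun k => base_coef x j * base_coef x k)) // ltnS ltn_ord.
case: K coef1 => [|K] coef1.
  exists 2%:R^-1; split; first exact/rationalV/rational_nat.
    by lra.
  by rewrite coef1 big_ord_recl big_ord0 /base_coef /= expr0 addr0 mul1r mulfV ?subrr.
pose S := \sum_(j < K) (3%:R^-1 : R) ^+ j.+2 * 3%:R^-1 ^+ j.+3.
have S0 : 0 <= S.
  by apply: sumr_ge0 => j _; rewrite mulr_ge0 // ltW //; case/andP: (expr_third_01 _).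
have S1 : S <= 27%:R^-1 * 2%:R^-1.
  apply: le_trans (_ : 27%:R^-1 * \sum_(j < K) (3%:R^-1 : R) ^+ j.+1 <= _); last first.
    by rewrite ler_pM2l ?invr_gt0 ?ltr0n // ltW // sum_geometric_third.
  rewrite mulr_sumr; apply: ler_sum => j _.
  have -> : (27%:R^-1 : R) = 3%:R^-1 ^+ 3 by field.
  by rewrite -!exprD; apply: ler_wiXn2l; [lra | lra | lia].
have sumE x : \sum_(j < K.+2) base_coef x j * base_coef x j.+1
    = x + x * 3%:R^-1 ^+ 2 + S.
  by rewrite !big_ord_recl /= /base_coef /= expr0 mul1r addrA.
exists ((1 - 2%:R * S) / (2%:R * (1 + 3%:R^-1 ^+ 2))); split.
- rewrite /S expr2; do ?[exact: rational_nat | exact: (rational_nat R 1) |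
    apply: rationalM | apply: rationalD | apply: rationalN | apply: rationalV].
  apply: rational_sum => j; rewrite !exprVn -!natrX.
  by apply: rationalM; apply/rationalV/rational_nat.
- by rewrite ler_pdivlMr ?ler_pdivrMr; lra.
- by rewrite coef1 sumE; field; lra.
Qed.

(** The frequencies 1, ..., 2K - 1 serve for odd m; for even m, [kappa] = 1 drops
    the frequency 1, whose coefficient has been made zero. *)
Lemma exists_sine_polynomial m : (0 < m)%N -> exists kappa K b (a : nat -> R),
  [/\ forall j, rational (b j), forall i, (i < m)%N -> 0 < a i &
    forall d, (\sum_(j < K) b j * sin (j.*2.+1%:R * d)) ^+ 2 =
      \sum_(i < m) a i * sin ((i.+1 + kappa)%:R * d) ^+ 2].
Proof.
move=> m0; have [modd|meven] := boolP (odd m).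
  pose b := base_coef 3%:R^-1; pose K := uphalf m.
  have mE : K.*2 = m.+1 by rewrite /K; lia.
  exists 0%N, K, b, (fun i => square_coef K b i.+1); split.
  - exact/rational_base_coef/rationalV/rational_nat.
  - move=> i im; apply: square_coef_gt0 => //; first by rewrite mE.
    + by apply: base_coef_01; lra.
    + by apply: base_coef_decr => //; case: i im => [|i] _; [right|left].
  - move=> d; rewrite sine_polynomial_square mE big_ord_recl /= mul0r sin0.
    rewrite expr0n /= mulr0 add0r.
    by apply: eq_bigr => i _; rewrite addn0.
have [x [xQ xI x1]] := exists_killing_coef m./2.-1.
pose b := base_coef x; pose K := m./2.-1.+2.
have mE : K.*2 = m.+2 by rewrite /K; lia.
exists 1%N, K, b, (fun i => square_coef K b i.+2); split.
- exact/rational_base_coef.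
- move=> i im; apply: square_coef_gt0 => //; first by rewrite mE.
  + exact: base_coef_01.
  + by apply: base_coef_decr; [case/andP: xI|left].
- move=> d; rewrite sine_polynomial_square mE !big_ord_recl /= mul0r sin0.
  rewrite expr0n /= mulr0 add0r.
  rewrite /bump /= add1n x1 mul0r add0r.
  by apply: eq_bigr => i _; rewrite addn1.
Qed.

End SinePolynomials.

(** * Order types, distances and configurations in even dimension *)

Section Homogeneous.
Variable R : realType.

Definition homogeneous_matrix d n (p : 'I_n -> 'rV[R]_d)
    (i : 'I_d.+1 -> 'I_n) : 'M[R]_d.+1 :=
  \matrix_(k < d.+1) (row_mx 1 (p (i k)) : 'rV[R]_d.+1).

Lemma row_mx1_0 d (x : 'rV[R]_d) : (row_mx 1 x : 'rV[R]_d.+1) 0 0 = 1.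
Proof.
have -> : (0 : 'I_d.+1) = lshift d (0 : 'I_1) by apply: val_inj.
by rewrite (row_mxEl (1 : 'rV[R]_1)) mxE.
Qed.

Lemma row_mx1_lift d (x : 'rV[R]_d) j : (row_mx 1 x : 'rV[R]_d.+1) 0 (lift 0 j) = x 0 j.
Proof. by rewrite -rshift1 (row_mxEr (1 : 'rV[R]_1)). Qed.

Lemma order_type_scale_columns d n (p : 'I_n -> 'rV[R]_d) (w : 'rV[R]_d) :
  (forall j, 0 < w 0 j) ->
  forall i, order_type (fun k => p k *m diag_mx w) i = order_type p i.
Proof.
move=> w0 i; rewrite /order_type.
pose w' : 'rV[R]_d.+1 := row_mx 1 w.
have -> : \matrix_(k < d.+1) (row_mx 1 (p (i k) *m diag_mx w) : 'rV[R]_d.+1)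
    = homogeneous_matrix p i *m diag_mx w'.
  apply/matrixP => a b; rewrite mul_mx_diag mxE [in RHS]mxE [in RHS]mxE /w'.
  case: (unliftP 0 b) => [b'|] ->; first by rewrite !row_mx1_lift mul_mx_diag mxE.
  by rewrite !row_mx1_0 mulr1.
rewrite det_mulmx det_diag sgrM [X in _ * X]gtr0_sg ?mulr1 //.
apply: prodr_gt0 => b _; rewrite /w'.
by case: (unliftP 0 b) => [b'|] ->; rewrite ?row_mx1_lift ?row_mx1_0.
Qed.

(** Both points occur in a common increasing tuple, whose determinant would
    vanish if they coincided. *)
Lemma alternating_neq d n (p : 'I_n.+1 -> 'rV[R]_d.+1) (i : 'I_n.+1) :
  (d.+1 <= n)%N -> alternating_order_type p -> i != 0 -> p i != p 0.
Proof.
move=> dn [e _ alt] i0; apply/eqP => pi0.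
have idxP (k : 'I_d.+2) : ((if k == d.+1 :> nat then maxn d.+1 i else k) < n.+1)%N.
  have := ltn_ord k; have := ltn_ord i; case: ifP => _; lia.
(* The tuple 0, 1, ..., d, max (d + 1, i), which contains both 0 and i. *)
pose idx k := Ordinal (idxP k).
have hidx : {homo idx : j k / (j < k)%N}.
  move=> j k; have := ltn_ord k; rewrite /idx /=.
  by case: eqP; case: eqP; lia.
have {alt} := alt idx hidx.
have [k k0 ki] : exists2 k : 'I_d.+2, 0 != k & idx k = i.
  have [id|di] := ltnP i d.+1.
    have i' : (i < d.+2)%N by lia.
    exists (Ordinal i'); first by move: i0; rewrite -!val_eqE /= eq_sym.
    by apply: val_inj; rewrite /= ltn_eqF.
  by exists ord_max => //; apply: val_inj => /=; rewrite eqxx; lia.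
have idx0 : idx 0 = 0 by apply: val_inj.
rewrite /order_type (determinant_alternate k0) ?sgr0 ?mulr0 => [/eqP|b].
  by rewrite eq_sym oner_eq0.
by rewrite !mxE ki idx0 pi0.
Qed.

End Homogeneous.

Section Distances.
Variable R : realType.

Lemma dot_product_mx d (x y : 'rV[R]_d) : dot_product x y = (x *m y^T) 0 0.
Proof. by rewrite /dot_product mxE; apply: eq_bigr => i _; rewrite mxE. Qed.

Lemma dot_productC d (x y : 'rV[R]_d) : dot_product x y = dot_product y x.
Proof. by apply: eq_bigr => i _; rewrite mulrC. Qed.

Lemma dot_productDl d (x y z : 'rV[R]_d) :
  dot_product (x + y) z = dot_product x z + dot_product y z.
Proof. by rewrite !dot_product_mx mulmxDl mxE. Qed.

Lemma dot_productZl d a (x z : 'rV[R]_d) :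
  dot_product (a *: x) z = a * dot_product x z.
Proof. by rewrite !dot_product_mx -scalemxAl mxE. Qed.

Lemma dot_productBl d (x y z : 'rV[R]_d) :
  dot_product (x - y) z = dot_product x z - dot_product y z.
Proof. by rewrite -scaleN1r dot_productDl dot_productZl mulN1r. Qed.

Lemma dot_productBr d (x y z : 'rV[R]_d) :
  dot_product z (x - y) = dot_product z x - dot_product z y.
Proof. by rewrite !(dot_productC z) dot_productBl. Qed.

Lemma dot_productZr d a (x z : 'rV[R]_d) :
  dot_product z (a *: x) = a * dot_product z x.
Proof. by rewrite !(dot_productC z) dot_productZl. Qed.

Lemma dot_product_ge0 d (x : 'rV[R]_d) : 0 <= dot_product x x.
Proof. by apply: sumr_ge0 => i _; rewrite -expr2 sqr_ge0. Qed.

Lemma dot_product_eq0 d (x : 'rV[R]_d) : (dot_product x x == 0) = (x == 0).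
Proof.
apply/idP/eqP => [|->]; last by rewrite /dot_product big1 // => i _; rewrite mxE mul0r.
rewrite psumr_eq0 => [/allP x0|i _]; last by rewrite -expr2 sqr_ge0.
apply/rowP => i; have := x0 i; rewrite mem_index_enum => /(_ isT).
by rewrite -expr2 sqrf_eq0 mxE => /eqP.
Qed.

Lemma euclidean_distZ d a (x y : 'rV[R]_d) : 0 <= a ->
  euclidean_dist (a *: x) (a *: y) = a * euclidean_dist x y.
Proof.
move=> a0; rewrite /euclidean_dist -scalerBr dot_productZl dot_productZr mulrA -expr2.
by rewrite sqrtrM ?sqr_ge0 // sqrtr_sqr ger0_norm.
Qed.

Lemma rational_common_denominator (I : finType) (F : I -> R) :
  (forall i, rational (F i)) ->
  exists2 c : nat, (0 < c)%N & forall i, c%:R * F i \is a Num.int.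
Proof.
move=> FQ.
have den i : exists c : nat, (0 < c)%N /\ c%:R * F i \is a Num.int.
  have [q _ <-] := FQ i; exists `|denq q|%N; split; first by rewrite absz_gt0 denq_neq0.
  have -> : (`|denq q|%N%:R : R) = ratr (denq q)%:~R.
    by rewrite ratr_int -[in RHS](gez0_abs (denq_ge0 q)) // -pmulrn.
  by rewrite -rmorphM mulrC -numqE rmorph_int rpred_int.
have [c cP] := choice den.
exists (\prod_i c i)%N => [|i]; first by rewrite prodn_gt0 // => i; case: (cP i).
rewrite (bigD1 i) //= mulnC natrM -mulrA rpredM ?rpred_nat //.
by case: (cP i).
Qed.

End Distances.

Section EvenDimension.
Variable R : realType.

Lemma rational_sin_multiple (d : R) k :
  rational (cos d) -> rational (sin d) ->
  rational (cos (k%:R * d)) /\ rational (sin (k%:R * d)).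
Proof.
move=> cQ sQ; elim: k => [|k [IHc IHs]].
  by rewrite mul0r cos0 sin0; split; [exact: (rational_nat R 1)|exact: (rational_nat R 0)].
rewrite -[k.+1%:R]natr1 mulrDl mul1r cosD sinD.
by split; do ?[apply: rationalD | apply: rationalN | apply: rationalM].
Qed.

Lemma sum_double (V : nmodType) m (F : nat -> V) :
  \sum_(j < m.*2) F j = \sum_(i < m) (F i.*2 + F i.*2.+1).
Proof.
elim: m => [|m IH]; first by rewrite !big_ord0.
by rewrite doubleS !big_ord_recr /= IH addrA.
Qed.

Lemma chord_square (x y : R) :
  (cos (2%:R * x) - cos (2%:R * y)) ^+ 2 + (sin (2%:R * x) - sin (2%:R * y)) ^+ 2
    = 4%:R * sin (x - y) ^+ 2.
Proof.
have -> : 2%:R * x = (x + y) + (x - y) by ring.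
have -> : 2%:R * y = (x + y) - (x - y) by ring.
move: (x + y) (x - y) => u v; rewrite cosD sinD cosB sinB.
have -> : 4%:R * sin v ^+ 2 = 4%:R * sin v ^+ 2 * (cos u ^+ 2 + sin u ^+ 2).
  by rewrite cos2Dsin2 mulr1.
by ring.
Qed.

(** The common norm is recorded because [contraction] needs points on a
    sphere about the origin. *)
Lemma exists_even_configuration m N : (0 < m)%N ->
  exists q : 'I_N -> 'rV[R]_m.*2,
    [/\ forall i j, rational (euclidean_dist (q i) (q j)),
        alternating_order_type q &
        exists rho, forall i, dot_product (q i) (q i) = rho].
Proof.
move=> m0; have [kappa [K [b [a [bQ a0 fE]]]]] := exists_sine_polynomial R m0.
have [th [thQ [e e1 alt]]] := exists_alternating_angles R kappa m N.
pose w : 'rV[R]_m.*2 := \row_j Num.sqrt (a j./2).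
pose p (i : 'I_N) : 'rV[R]_m.*2 := \row_j trig_column kappa j.+1 (th i).
have a0' (j : 'I_m.*2) : 0 < a j./2 by apply: a0; have := ltn_ord j; lia.
have w0 j : 0 < w 0 j by rewrite mxE sqrtr_gt0.
pose q i := p i *m diag_mx w.
have qE i (j : 'I_m.*2) : q i 0 j = trig_column kappa j.+1 (th i) * Num.sqrt (a j./2).
  by rewrite /q mul_mx_diag !mxE.
have odd_col i t : trig_column kappa i.*2.+1 t = cos (2%:R * ((i.+1 + kappa)%:R * t)) :> R.
  rewrite /trig_column /= odd_double /frequency /= doubleK.
  by rewrite -mul2n natrM mulrA.
have even_col i t : trig_column kappa i.*2.+2 t = sin (2%:R * ((i.+1 + kappa)%:R * t)) :> R.
  rewrite /trig_column /= odd_double /frequency /= uphalf_double.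
  by rewrite -mul2n natrM mulrA.
exists q; split.
- move=> i j; set d := th i - th j.
  pose f := \sum_(l < K) b l * sin (l.*2.+1%:R * d).
  have fQ : rational f.
    have [[ciQ siQ] [cjQ sjQ]] := (thQ i, thQ j).
    have dQ : rational (cos d) /\ rational (sin d).
      by rewrite cosB sinB; split; do ?[apply: rationalD | apply: rationalN | apply: rationalM].
    apply: rational_sum => l; apply: rationalM => //.
    by case: (rational_sin_multiple l.*2.+1 dQ.1 dQ.2).
  suff -> : euclidean_dist (q i) (q j) = `|2%:R * f|.
    by apply/rational_norm/rationalM => //; apply: rational_nat.
  rewrite -sqrtr_sqr /euclidean_dist; congr (Num.sqrt _).
  rewrite exprMn fE /dot_product.
  pose F l := a l./2 * (trig_column kappa l.+1 (th i) - trig_column kappa l.+1 (th j)) ^+ 2.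
  rewrite (eq_bigr (fun l : 'I_m.*2 => F l)) => [|l _]; last first.
    rewrite [(q i - q j) 0 l]mxE [(- q j) 0 l]mxE !qE -mulrBl -expr2 exprMn sqr_sqrtr 1?mulrC //.
    exact: ltW.
  rewrite sum_double mulr_sumr; apply: eq_bigr => l _.
  rewrite /F /= uphalf_double doubleK -mulrDr !odd_col !even_col chord_square.
  by rewrite -mulrBr -/d -natrX; ring.
- exists e => // i ih; rewrite order_type_scale_columns // /order_type.
  have -> : \matrix_(k < m.*2.+1) (row_mx 1 (p (i k)) : 'rV[R]_m.*2.+1)
     = \matrix_(k, l) trig_column kappa l (th (i k)).
    apply/matrixP => k l; rewrite [LHS]mxE [RHS]mxE.
    case: (unliftP 0 l) => [l'|] ->; first by rewrite row_mx1_lift mxE.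
    by rewrite row_mx1_0.
  have := alt i ih; case: e1 => ->; rewrite ?mul1r ?mulN1r ?oppr_gt0 => h.
    by rewrite gtr0_sg.
  by rewrite ltr0_sg // opprK.
- exists (\sum_(l < m) a l) => i.
  pose F l := a l./2 * trig_column kappa l.+1 (th i) ^+ 2.
  rewrite /dot_product (eq_bigr (fun l : 'I_m.*2 => F l)) => [|l _]; last first.
    by rewrite qE -expr2 exprMn sqr_sqrtr 1?mulrC // ltW.
  rewrite sum_double; apply: eq_bigr => l _.
  rewrite /F /= uphalf_double doubleK -mulrDr !odd_col !even_col.
  by rewrite cos2Dsin2 mulr1.
Qed.

End EvenDimension.

(** * Contraction of a spherical configuration *)

Section Contraction.
Variable R : realType.

(** The reflection in the hyperplane orthogonal to v; for v = 0 the convention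
    2 / 0 = 0 makes it the identity, so that it is an isometry for every v. *)
Definition householder d (v : 'rV[R]_d) : 'M[R]_d :=
  1%:M - (2%:R / dot_product v v) *: (v^T *m v).

Lemma mul_householder d (x v : 'rV[R]_d) :
  x *m householder v = x - (2%:R * dot_product x v / dot_product v v) *: v.
Proof.
rewrite /householder mulmxBr mulmx1; congr (_ - _).
rewrite -scalemxAr mulmxA [x *m v^T]mx11_scalar -dot_product_mx mul_scalar_mx scalerA.
by congr (_ *: _); ring.
Qed.

Lemma dot_householder d (v x y : 'rV[R]_d) :
  dot_product (x *m householder v) (y *m householder v) = dot_product x y.
Proof.
rewrite !mul_householder !dot_productBl !dot_productBr !dot_productZl !dot_productZr.
have [v0|v0] := eqVneq (dot_product v v) 0.
  by rewrite v0 invr0 !mulr0 !mul0r !subr0.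
by rewrite [dot_product v y]dot_productC; field.
Qed.

Lemma det_householder_neq0 d (v : 'rV[R]_d) : \det (householder v) != 0.
Proof.
suff E : householder v *m householder v = 1%:M.
  have := congr1 determinant E; rewrite det_mulmx det1 => D.
  by apply/eqP => H; move/eqP: D; rewrite H mul0r eq_sym oner_eq0.
apply/row_matrixP => i; rewrite row_mul row1 rowE -mulmxA.
set x := delta_mx 0 i; rewrite mulmxA !mul_householder.
rewrite dot_productBl dot_productZl -addrA -opprD -scalerDl.
have [v0|v0] := eqVneq (dot_product v v) 0.
  by rewrite v0 invr0 !mulr0 addr0 scale0r subr0.
rewrite [X in X *: _](_ : _ = 0) ?scale0r ?subr0 //.
by field.
Qed.

(** Provides the isometry that moves the hyperplane containing the inverted points
    to a hyperplane orthogonal to the first axis, where a coordinate can be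
    dropped. *)
Lemma householder_to_axis d (x : 'rV[R]_d.+1) :
  let r := Num.sqrt (dot_product x x) in
  x *m householder (x - r *: delta_mx 0 0) = r *: delta_mx 0 0.
Proof.
set r := Num.sqrt _; set e0 := delta_mx 0 0 => /=; set v := x - _.
have r2 : dot_product x x = r * r by rewrite -expr2 sqr_sqrtr ?dot_product_ge0.
have ee : dot_product e0 e0 = 1.
  rewrite /dot_product (bigD1 0) //= big1 ?addr0 => [|i /negPf i0].
    by rewrite !mxE !eqxx mulr1.
  by rewrite !mxE i0 andbF mul0r.
rewrite mul_householder.
have vv : dot_product v v = 2%:R * dot_product x v.
  rewrite !dot_productBl !dot_productBr !dot_productZl !dot_productZr ee r2.
  by rewrite [dot_product e0 x]dot_productC; ring.
have [v0|v0] := eqVneq (dot_product v v) 0.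
  have /eqP : v == 0 by rewrite -dot_product_eq0 v0.
  by rewrite v0 invr0 mulr0 scale0r subr0 => /eqP; rewrite subr_eq0 => /eqP.
by rewrite -vv divff // scale1r /v opprB addrC subrK.
Qed.

(** Subtracting the first row from the others: the orientation of a simplex with
    apex q 0 is that of its edge vectors at the apex. *)
Lemma det_homogeneous_cone d n (q : 'I_n.+1 -> 'rV[R]_d) (i : 'I_d -> 'I_n) :
  \det (homogeneous_matrix q
    (fun k => if unlift 0 k is Some l then lift 0 (i l) else 0)) =
  \det (\matrix_(k < d) (q (lift 0 (i k)) - q 0)).
Proof.
set B := \matrix_(k < d) (q (lift 0 (i k)) - q 0).
have -> : homogeneous_matrix q
    (fun k => if unlift 0 k is Some l then lift 0 (i l) else 0) =
    (block_mx 1%:M 0 (const_mx 1) 1%:M : 'M[R]_(1 + d)) *m block_mx 1%:M (q 0) 0 B.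
  rewrite mulmx_block !mul1mx !mulmx1 !mul0mx !addr0 /block_mx.
  apply/row_matrixP => k; rewrite rowK /=.
  case: (unliftP 0 k) => [l|] ->.
    rewrite -[in RHS]rshift1 (@rowKd _ 1).
    apply/rowP => j; rewrite !mxE; case: (@fintype.split 1 d j) => j'; rewrite !mxE ?ord1 //.
    by rewrite big_ord_recl big_ord0 !mxE mul1r addr0 addrC subrK.
  have -> : (0 : 'I_d.+1) = lshift d (0 : 'I_1) by apply: val_inj.
  by rewrite (@rowKu _ 1) row_id.
by rewrite det_mulmx (@det_lblock R 1 d) (@det_ublock R 1 d) !det1 !mul1r.
Qed.

(** Inversion about q 0 sends a sphere through q 0 to a hyperplane and divides
    the distance of two points by the product of their distances to q 0.  It also
    multiplies the vectors issued from q 0 by positive numbers, so that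
    orientations are those of the simplices with apex q 0. *)
Lemma contraction d n (q : 'I_n.+1 -> 'rV[R]_d.+1) rho :
  (d.+1 <= n)%N ->
  (forall i j, rational (euclidean_dist (q i) (q j))) ->
  alternating_order_type q ->
  (forall i, dot_product (q i) (q i) = rho) ->
  exists z : 'I_n -> 'rV[R]_d,
    (forall i j, rational (euclidean_dist (z i) (z j))) /\ alternating_order_type z.
Proof.
move=> dn qQ alt qrho.
pose D i := dot_product (q i - q 0) (q i - q 0).
have Dpos (i : 'I_n) : 0 < D (lift 0 i).
  rewrite lt_neqAle dot_product_ge0 andbT eq_sym dot_product_eq0 subr_eq0.
  exact: alternating_neq.
have DE i : D i = 2%:R * (rho - dot_product (q i) (q 0)).
  rewrite /D !dot_productBl !dot_productBr !qrho [dot_product (q 0) _]dot_productC.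
  by ring.
pose r := Num.sqrt rho.
have r2 : r * r = rho by rewrite -expr2 sqr_sqrtr // -(qrho 0) dot_product_ge0.
pose W := householder (q 0 - r *: delta_mx 0 0).
have q0W : q 0 *m W = r *: delta_mx 0 0.
  by have := householder_to_axis (q 0); rewrite qrho.
pose y (i : 'I_n) := (D (lift 0 i))^-1 *: (q (lift 0 i) - q 0).
pose z i : 'rV[R]_d := \row_j (y i *m W) 0 (lift 0 j).
(* The inverted points lie in a hyperplane orthogonal to q 0. *)
have y0 i : r * (y i *m W) 0 0 = - 2%:R^-1.
  have <- : dot_product (y i *m W) (q 0 *m W) = r * (y i *m W) 0 0.
    rewrite q0W dot_productZr; congr (_ * _).
    rewrite /dot_product (bigD1 0) //= big1 ?addr0 => [|j /negPf j0].
      by rewrite [delta_mx _ _ _ _]mxE !eqxx mulr1.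
    by rewrite [delta_mx _ _ _ _]mxE j0 andbF mulr0.
  rewrite dot_householder dot_productZl dot_productBl qrho.
  have := Dpos i; rewrite DE => pos.
  by field; lra.
have r0 : r != 0.
  have n0 : (0 < n)%N by apply: leq_trans dn.
  apply/eqP => r0; have := y0 (Ordinal n0); rewrite r0 mul0r => /eqP.
  by rewrite eq_sym oppr_eq0 invr_eq0 pnatr_eq0.
pose c := - 2%:R^-1 / r.
have y0c i : (y i *m W) 0 0 = c by rewrite /c -(y0 i) mulrC mulKf.
have c0 : c != 0 by rewrite mulf_neq0 ?invr_eq0 // oppr_eq0 invr_eq0 pnatr_eq0.
have dotz i j : dot_product (z i - z j) (z i - z j) = dot_product (y i - y j) (y i - y j).
  rewrite -(dot_householder (q 0 - r *: delta_mx 0 0)) -/W [RHS]/dot_product big_ord_recl.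
  rewrite [X in X * _](_ : _ = 0) ?mul0r ?add0r; last first.
    by rewrite mulmxBl mxE [(- (_ *m _)) 0 0]mxE !y0c subrr.
  by apply: eq_bigr => k _; rewrite mulmxBl !mxE.
exists z; split.
  move=> i j.
  suff -> : euclidean_dist (z i) (z j) =
     euclidean_dist (q (lift 0 i)) (q (lift 0 j))
     / (euclidean_dist (q (lift 0 i)) (q 0) * euclidean_dist (q (lift 0 j)) (q 0)).
    by apply: rationalM => //; apply/rationalV/rationalM.
  rewrite /euclidean_dist dotz -sqrtrM ?dot_product_ge0 // -sqrtrV ?mulr_ge0 ?dot_product_ge0 //.
  rewrite -sqrtrM ?dot_product_ge0 //; congr (Num.sqrt _).
  have -> : q (lift 0 i) - q (lift 0 j) = (q (lift 0 i) - q 0) - (q (lift 0 j) - q 0).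
    by rewrite opprB addrA subrK.
  rewrite /y; have := Dpos i; have := Dpos j; rewrite /D.
  move: (q (lift 0 i) - q 0) (q (lift 0 j) - q 0) => u v v0 u0.
  rewrite !dot_productBl !dot_productBr !dot_productZl !dot_productZr.
  by rewrite [dot_product v u]dot_productC; field; rewrite !gt_eqF.
have [e e1 altq] := alt.
pose s := Num.sg (\det W / c).
have s1 : s = 1 \/ s = -1.
  have : \det W / c != 0 by rewrite mulf_neq0 ?det_householder_neq0 ?invr_eq0.
  by rewrite neq_lt => /orP[/ltr0_sg|/gtr0_sg] H; [right|left].
exists (e * s).
  by case: e1 s1 => -> [] ->; rewrite ?mul1r ?mulN1r ?opprK; [left|right|right|left].
move=> i ih.
pose i' (k : 'I_d.+2) : 'I_n.+1 := if unlift 0 k is Some l then lift 0 (i l) else 0.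
have ih' : {homo i' : j k / (j < k)%N}.
  move=> j k; rewrite /i'; case: (unliftP 0 j) => [j'|] ->; case: (unliftP 0 k) => [k'|] -> //=.
  by rewrite /bump !leq0n !add1n !ltnS; apply: ih.
have := altq i' ih'; rewrite /order_type => <-.
rewrite -[\matrix_(k < d.+2) _]/(homogeneous_matrix q i') det_homogeneous_cone.
set B := \matrix_(k < d.+1) (q (lift 0 (i k)) - q 0).
set Z := \matrix_(k < d.+1) (row_mx 1 (z (i k)) : 'rV[R]_d.+1).
pose cv : 'rV[R]_d.+1 := \row_j (if j == 0 then c else 1).
have ZE : Z *m diag_mx cv = diag_mx (\row_k (D (lift 0 (i k)))^-1) *m B *m W.
  apply/row_matrixP => k; rewrite !row_mul.
  have -> : row k (diag_mx (\row_k (D (lift 0 (i k)))^-1)) *m B = y (i k).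
    by apply/rowP => b; rewrite -row_mul mxE mul_diag_mx !mxE.
  apply/rowP => b; rewrite mul_mx_diag [LHS]mxE [row _ _ _ _]mxE [Z _ _]mxE [cv _ _]mxE.
  case: (unliftP 0 b) => [b'|] ->; last by rewrite row_mx1_0 mul1r y0c.
  by rewrite row_mx1_lift mulr1 mxE.
have detcv : \prod_j cv 0 j = c.
  by rewrite big_ord_recl mxE eqxx big1 ?mulr1 // => j _; rewrite mxE.
have detZ : \det Z = (\prod_k (\row_k (D (lift 0 (i k)))^-1) 0 k) * \det B * (\det W / c).
  have := congr1 determinant ZE; rewrite !det_mulmx !det_diag detcv => E.
  by apply: (mulIf c0); rewrite E; field.
have prod0 : 0 < \prod_k (\row_k (D (lift 0 (i k)))^-1) 0 k.
  by apply: prodr_gt0 => k _; rewrite mxE invr_gt0.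
rewrite detZ 2!sgrM (gtr0_sg prod0) -/s.
have ss : s * s = 1 by case: s1 => ->; rewrite ?mulr1 // mulrNN mulr1.
by rewrite mul1r -mulrA [s * _]mulrC -mulrA ss mulr1.
Qed.

End Contraction.

(** * Supporting index sets of alternating configurations *)

Section SupportingSets.
Variable R : realType.

Definition affine_value d (w : 'rV[R]_d.+1) (x : 'rV[R]_d) : R :=
  dot_product w (row_mx 1 x : 'rV[R]_d.+1).

(** A face contains exactly the points with indices in such a set, the improper faces
    included; see [supporting_face] and [face_supporting]. *)
Definition supporting d n (p : 'I_n -> 'rV[R]_d) (S : {set 'I_n}) : Prop :=
  exists w : 'rV[R]_d.+1, forall i,
    if i \in S then affine_value w (p i) = 0 else 0 < affine_value w (p i).

Lemma affine_valueD d (w w' : 'rV[R]_d.+1) x :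
  affine_value (w + w') x = affine_value w x + affine_value w' x.
Proof. exact: dot_productDl. Qed.

Lemma affine_valueZ d a (w : 'rV[R]_d.+1) x :
  affine_value (a *: w) x = a * affine_value w x.
Proof. exact: dot_productZl. Qed.

Lemma affine_value0 d (x : 'rV[R]_d) : affine_value 0 x = 0.
Proof. by rewrite -(scale0r 0) affine_valueZ mul0r. Qed.

Lemma homogeneous_matrix_mul d n (p : 'I_n -> 'rV[R]_d) i (w : 'rV[R]_d.+1) k :
  (w *m (homogeneous_matrix p i)^T) 0 k = affine_value w (p (i k)).
Proof.
rewrite mxE; apply: eq_bigr => j _.
by rewrite [_^T _ _]mxE [homogeneous_matrix _ _ _ _]mxE.
Qed.

Lemma exists_sorting_perm n k (i : 'I_k -> 'I_n) : injective i ->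
  exists s : 'S_k, {homo (fun a => i (s a)) : a b / (a < b)%N}.
Proof.
move=> inj; pose t := [tuple val (i x) | x < k].
have /tuple_permP[s sE] : perm_eq (sort leq t) t by rewrite perm_sort.
have st : sorted ltn (sort leq t).
  rewrite ltn_sorted_uniq_leq sort_sorted ?andbT; last exact: leq_total.
  rewrite sort_uniq; apply/tuple_uniqP => a b.
  by rewrite !tnth_mktuple => /val_inj/inj.
exists s => a b ab.
have sz : size (sort leq t) = k by rewrite size_sort size_tuple.
have nthE c : nth 0%N (sort leq t) (val c) = i (s c).
  by rewrite sE -tnth_nth !tnth_mktuple.
by rewrite -!nthE; apply: (sorted_ltn_nth ltn_trans) => //; rewrite inE sz ltn_ord.
Qed.

(** Sorting an injective tuple multiplies its determinant by the signature, so the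
    signs on increasing tuples determine all signs. *)
Lemma alternating_orientation d n (p : 'I_n -> 'rV[R]_d) :
  alternating_order_type p -> exists2 e : R, e = 1 \/ e = -1 &
  forall (i : 'I_d.+1 -> 'I_n) (s : 'S_d.+1),
    {homo (fun a => i (s a)) : a b / (a < b)%N} ->
    Num.sg (\det (homogeneous_matrix p i)) = e * (-1) ^+ s.
Proof.
move=> [e e1 alt]; exists e => // i s /alt; rewrite /order_type.
rewrite -[\matrix_(k < d.+1) _]/(homogeneous_matrix p (fun a => i (s a))).
have -> : homogeneous_matrix p (fun a => i (s a)) = perm_mx s *m homogeneous_matrix p i.
  by rewrite -row_permE; apply/matrixP => a b; rewrite [RHS]mxE !mxE.
rewrite det_mulmx det_perm sgrM => E.
have ee : e * e = 1 by case: e1 => ->; rewrite ?mulr1 // mulrNN mulr1.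
rewrite -[LHS]mul1r -[X in X * _]ee -mulrA; congr (_ * _).
move: E; case: (odd_perm s); rewrite ?expr1 ?expr0 ?sgrN sgr1 ?mul1r // => E.
by apply: oppr_inj; rewrite opprK -E mulN1r mulrN.
Qed.

Lemma alternating_det_neq0 d n (p : 'I_n -> 'rV[R]_d) (i : 'I_d.+1 -> 'I_n) :
  alternating_order_type p -> injective i -> \det (homogeneous_matrix p i) != 0.
Proof.
move=> /alternating_orientation [e e1 eP] /exists_sorting_perm [s /eP].
move=> E; rewrite -sgr_eq0 E mulf_neq0 ?signr_eq0 //.
by case: e1 => ->; rewrite ?oppr_eq0 oner_eq0.
Qed.

Lemma alternating_functional_eq0 d n (p : 'I_n -> 'rV[R]_d) (i : 'I_d.+1 -> 'I_n)
    (w : 'rV[R]_d.+1) :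
  alternating_order_type p -> injective i ->
  (forall k, affine_value w (p (i k)) = 0) -> w = 0.
Proof.
move=> alt inj w0.
have u : (homogeneous_matrix p i)^T \in unitmx.
  by rewrite unitmx_tr unitmxE unitfE alternating_det_neq0.
rewrite -[w]mulmx1 -(mulmxV u) mulmxA [w *m _](_ : _ = 0) ?mul0mx //.
by apply/rowP => k; rewrite homogeneous_matrix_mul w0 mxE.
Qed.

Lemma supportingI d n (p : 'I_n -> 'rV[R]_d) S T :
  supporting p S -> supporting p T -> supporting p (S :&: T).
Proof.
move=> [w wP] [v vP]; exists (w + v) => i; rewrite affine_valueD inE.
have := wP i; have := vP i; case: ifP => _; case: ifP => _ /=.
- by move=> -> ->; rewrite addr0.
- by move=> -> ?; rewrite addr0.
- by move=> ? ->; rewrite add0r.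
- by move=> ? ?; rewrite addr_gt0.
Qed.

Definition facet_index d n (s : 'I_d -> 'I_n) (x : 'I_n) (k : 'I_d.+1) : 'I_n :=
  if unlift 0 k is Some l then s l else x.

Lemma facet_index0 d n (s : 'I_d -> 'I_n) x : facet_index s x 0 = x.
Proof. by rewrite /facet_index unlift_none. Qed.

Lemma facet_index_lift d n (s : 'I_d -> 'I_n) x l : facet_index s x (lift 0 l) = s l.
Proof. by rewrite /facet_index liftK. Qed.

(** The determinant is affine in the point placed in its first row. *)
Lemma facet_functional d n (p : 'I_n -> 'rV[R]_d) (s : 'I_d -> 'I_n) :
  exists w : 'rV[R]_d.+1, forall x,
    affine_value w (p x) = \det (homogeneous_matrix p (facet_index s x)).
Proof.
have [n0|n0] := posnP n.
  by exists 0 => x; have := ltn_ord x; rewrite {2}n0.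
pose x0 := Ordinal n0.
exists (\row_j cofactor (homogeneous_matrix p (facet_index s x0)) 0 j) => x.
rewrite (expand_det_row _ 0); apply: eq_bigr => j _.
rewrite mxE mulrC [homogeneous_matrix _ _ _ _]mxE /facet_index unlift_none.
congr (_ * (_ * \det _)); apply/matrixP => a b; rewrite !mxE.
by rewrite !liftK.
Qed.

(** A functional vanishing at d points is unique up to a factor, so the given one
    is proportional to the determinant whose other rows are these points.  The
    signs of that determinant are, up to a global sign, common to p and q. *)
Lemma supporting_facet d n (p q : 'I_n -> 'rV[R]_d) (S : {set 'I_n}) :
  alternating_order_type p -> alternating_order_type q -> #|S| = d ->
  supporting p S -> supporting q S.
Proof.
move=> altp altq Sd [w wP].
pose s (l : 'I_d) : 'I_n := enum_val (cast_ord (esym Sd) l).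
have sS l : s l \in S by apply: enum_valP.
have sinj : injective s by move=> a b /enum_val_inj/cast_ord_inj.
have s_onto i : i \in S -> exists l, s l = i.
  move=> iS; exists (cast_ord Sd (enum_rank_in iS i)).
  by rewrite /s cast_ordK enum_rankK_in.
have idx_inj x : x \notin S -> injective (facet_index s x).
  move=> xS a b; rewrite /facet_index.
  case: (unliftP 0 a) => [a'|] ->; case: (unliftP 0 b) => [b'|] -> //.
  - by move=> /sinj ->.
  - by move=> E; move: xS; rewrite -E sS.
  - by move=> E; move: xS; rewrite E sS.
have det0 (r : 'I_n -> 'rV[R]_d) x : x \in S ->
    \det (homogeneous_matrix r (facet_index s x)) = 0.
  move=> /s_onto [l lx]; apply: (@determinant_alternate _ _ _ 0 (lift 0 l)) => // b.
  by rewrite !mxE /facet_index unlift_none liftK lx.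
have [wp wpE] := facet_functional p s.
have [wq wqE] := facet_functional q s.
have [->|] := eqVneq S [set: 'I_n]%SET.
  by exists 0 => i; rewrite inE affine_value0.
rewrite -finset.subTset => /subsetPn [x0 _ x0S].
pose Dp x := \det (homogeneous_matrix p (facet_index s x)).
pose Dq x := \det (homogeneous_matrix q (facet_index s x)).
have h0 x : x \notin S -> 0 < affine_value w (p x).
  by move=> /negPf xS; have := wP x; rewrite xS.
have prop x : Dp x0 * affine_value w (p x) = affine_value w (p x0) * Dp x.
  have u0 : Dp x0 *: w + (- affine_value w (p x0)) *: wp = 0.
    apply: (alternating_functional_eq0 altp (idx_inj x0 x0S)) => k.
    rewrite affine_valueD !affine_valueZ wpE.
    case: (unliftP 0 k) => [l|] ->; last first.
      by rewrite facet_index0 -/(Dp x0) mulNr mulrC subrr.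
    have := wP (s l); rewrite sS facet_index_lift => ->.
    by rewrite det0 // !mulr0 addr0.
  have := affine_value0 (p x); rewrite -{1}u0 affine_valueD !affine_valueZ wpE.
  by move/eqP; rewrite mulNr subr_eq0 => /eqP.
have [ep ep1 epP] := alternating_orientation altp.
have [eq eq1 eqP'] := alternating_orientation altq.
have sgpq x : x \notin S -> Num.sg (Dq x) = ep * eq * Num.sg (Dp x0).
  move=> xS; have <- : Num.sg (Dp x) = Num.sg (Dp x0).
    have := congr1 Num.sg (prop x); rewrite !sgrM (gtr0_sg (h0 x xS)) (gtr0_sg (h0 x0 x0S)).
    by rewrite mulr1 mul1r => ->.
  have [t tP] := exists_sorting_perm (idx_inj x xS).
  rewrite /Dq /Dp (epP _ _ tP) (eqP' _ _ tP).
  by case: ep1 => ->; rewrite ?mul1r // !mulN1r mulrN !mulNr opprK.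
exists ((ep * eq * Num.sg (Dp x0)) *: wq) => i.
rewrite affine_valueZ wqE -/(Dq i); case: ifPn => iS; first by rewrite /Dq det0 ?mulr0.
rewrite -(sgpq i iS) -normrEsg normr_gt0.
by apply: alternating_det_neq0 => //; apply: idx_inj.
Qed.

(** Here d + 1 affinely independent points lie in the zero set, so the
    functional is zero and S contains every index. *)
Lemma supporting_large d n (p q : 'I_n -> 'rV[R]_d) (S : {set 'I_n}) :
  alternating_order_type p -> (d < #|S|)%N -> supporting p S -> supporting q S.
Proof.
move=> alt dS [w wP].
pose i (k : 'I_d.+1) : 'I_n := enum_val (widen_ord dS k).
have inj : injective i by move=> a b /enum_val_inj/(congr1 val) ab; apply: val_inj.
have w0 : w = 0.
  apply: (alternating_functional_eq0 alt inj) => k.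
  by have := wP (i k); rewrite enum_valP.
exists 0 => k; rewrite affine_value0; have := wP k.
by rewrite w0 affine_value0 ltxx; case: ifP.
Qed.

Lemma exists_vanishing_functional d n (p : 'I_n -> 'rV[R]_d) (T : {set 'I_n}) :
  (#|T| <= d)%N -> exists2 g : 'rV[R]_d.+1, g != 0 &
    forall i, i \in T -> affine_value g (p i) = 0.
Proof.
move=> Td.
pose A : 'M[R]_(#|T|, d.+1) :=
  \matrix_(k < #|T|) (row_mx 1 (p (enum_val k)) : 'rV[R]_d.+1).
have : kermx A^T != 0.
  by rewrite kermx_eq0 /row_free neq_ltn ltnS (leq_trans (rank_leq_col _)).
move=> /rowV0Pn [g /sub_kermxP gA g0]; exists g => // i iT.
have := congr1 (fun M : 'rV[R]_#|T| => M 0 (enum_rank_in iT i)) gA.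
rewrite [RHS]mxE => <-; rewrite mxE; apply: eq_bigr => j _.
by rewrite [_^T _ _]mxE [A _ _]mxE enum_rankK_in.
Qed.

(** Add to the supporting functional the largest multiple of g that keeps it
    nonnegative: a point with g < 0 joins the zero set.  If g is nowhere negative,
    then g itself supports a larger set, which contains j. *)
Lemma supporting_grow d n (p : 'I_n -> 'rV[R]_d) (S : {set 'I_n}) (j : 'I_n)
    (g : 'rV[R]_d.+1) :
  supporting p S -> j \notin S ->
  (forall i, i \in j |: S -> affine_value g (p i) = 0) ->
  exists T : {set 'I_n}, [/\ supporting p T, S \proper T &
    forall i, i \in T -> i \notin S -> affine_value g (p i) < 0 \/
      (forall k, 0 <= affine_value g (p k)) /\ affine_value g (p i) = 0].
Proof.
move=> [w wP] jS g0.
have gS i : i \in S -> affine_value g (p i) = 0.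
  by move=> iS; apply: g0; rewrite inE iS orbT.
have gj : affine_value g (p j) = 0 by apply: g0; rewrite setU11.
have wS i : i \in S -> affine_value w (p i) = 0 by move=> iS; have := wP i; rewrite iS.
have wpos i : i \notin S -> 0 < affine_value w (p i).
  by move=> /negPf iS; have := wP i; rewrite iS.
have [[i1 i1neg]|nneg] := pselect (exists i, affine_value g (p i) < 0); last first.
  have gge k : 0 <= affine_value g (p k).
    by rewrite leNgt; apply/negP => gk; apply: nneg; exists k.
  exists [set i | affine_value g (p i) == 0]%SET; split.
  - exists g => i; rewrite inE; case: eqP => // /eqP gi.
    by rewrite lt_neqAle eq_sym gi gge.
  - apply/properP; split; last by exists j => //; rewrite inE gj.
    by apply/fintype.subsetP => i iS; rewrite inE gS.
  - by move=> i; rewrite inE => /eqP gi _; right.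
pose f i := affine_value w (p i) / - affine_value g (p i).
have [i0 i0neg i0min] : exists2 i0, affine_value g (p i0) < 0 &
    forall i, affine_value g (p i) < 0 -> f i0 <= f i.
  have := @arg_minP _ _ _ i1 (fun i => affine_value g (p i) < 0) f i1neg.
  by case=> i0 ? ?; exists i0.
have nS i : affine_value g (p i) < 0 -> i \notin S.
  by apply: contraTN => /gS ->; rewrite ltxx.
have eps0 : 0 < f i0 by rewrite divr_gt0 ?oppr_gt0 // wpos // nS.
pose v := w + f i0 *: g.
have vE i : affine_value v (p i) = affine_value w (p i) + f i0 * affine_value g (p i).
  by rewrite affine_valueD affine_valueZ.
have vge i : 0 <= affine_value v (p i).
  rewrite vE; have [gi|gi] := ltP (affine_value g (p i)) 0.
    have := i0min i gi; rewrite {2}/f ler_pdivlMr ?oppr_gt0 // mulrN.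
    by rewrite -subr_ge0 opprK.
  apply: addr_ge0; last by rewrite mulr_ge0 // ltW.
  by have := wP i; case: ifP => _; [move=> ->|move=> /ltW].
exists [set i | affine_value v (p i) == 0]%SET; split.
- exists v => i; rewrite inE; case: eqP => // /eqP vi.
  by rewrite lt_neqAle eq_sym vi vge.
- apply/properP; split.
    by apply/fintype.subsetP => i iS; rewrite inE vE gS // wS // mulr0 addr0.
  exists i0; last exact: nS.
  rewrite inE vE /f invrN mulrN mulNr divfK ?subrr //.
  by rewrite lt_eqF.
- move=> i; rewrite inE => /eqP vi iS; left.
  have := wpos i iS; rewrite -(pmulr_rlt0 _ eps0).
  by move: vi; rewrite vE => /eqP; rewrite addr_eq0 => /eqP ->; rewrite oppr_gt0.
Qed.

(** By induction on the size of the complement of S.  If S has fewer than d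
    elements, choose a nonzero g vanishing on S and at one more point.  Moving the
    functional in the directions g and -g produces two larger supporting sets that
    meet in S, because g has opposite signs on what they add.  This is the
    decomposition of a face as an intersection of facets. *)
Lemma supporting_alternating d n (p q : 'I_n -> 'rV[R]_d) (S : {set 'I_n}) :
  (d < n)%N -> alternating_order_type p -> alternating_order_type q ->
  supporting p S -> supporting q S.
Proof.
move=> dn altp altq.
have [m] := ubnP #|~: S|; elim: m S => // m IH S Sm suppS.
have [Sd|dS|Sd] := ltngtP #|S| d; last 2 first.
- exact: supporting_large altp dS suppS.
- exact: supporting_facet altp altq Sd suppS.
have [j jS] : exists j, j \notin S.
  have [SE|] := eqVneq S [set: 'I_n]%SET.
    by move: Sd; rewrite SE cardsT card_ord ltnNge (ltnW dn).
  by rewrite -finset.subTset => /subsetPn [j _ jS]; exists j.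
have [|g g0 gv] := @exists_vanishing_functional d n p (j |: S).
  by rewrite cardsU1 jS.
have [T1 [supp1 prop1 T1P]] := supporting_grow suppS jS gv.
have gNE i : affine_value (- g) (p i) = - affine_value g (p i).
  by rewrite -scaleN1r affine_valueZ mulN1r.
have [|T2 [supp2 prop2 T2P]] := @supporting_grow d n p S j (- g) suppS jS.
  by move=> i iS; rewrite gNE gv ?oppr0.
have grow (T : {set 'I_n}) : S \proper T -> (#|~: T| < m)%N.
  move=> /proper_card ST; rewrite -ltnS; apply: leq_trans Sm.
  by rewrite ltnS; move: (cardsC S) (cardsC T); rewrite card_ord; lia.
suff -> : S = T1 :&: T2 by apply: supportingI; apply: IH => //; apply: grow.
apply/eqP; rewrite finset.eqEsubset finset.subsetI (proper_sub prop1) (proper_sub prop2) /=.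
apply/fintype.subsetP => i; rewrite inE => /andP[i1 i2]; apply: contraT => iS.
have := T1P i i1 iS; have := T2P i i2 iS; rewrite gNE oppr_lt0.
case=> [g2|[g2 /eqP g2i]]; case=> [g1|[g1 g1i]].
- by rewrite -(lt_asym 0 (affine_value g (p i))) g2.
- by move: g2; rewrite g1i ltxx.
- by move: g2i g1; rewrite oppr_eq0 => /eqP ->; rewrite ltxx.
case/eqP: g0.
have inj : injective (widen_ord dn) by move=> x y /(congr1 val) xy; apply: val_inj.
apply: (alternating_functional_eq0 altp inj) => k.
by apply/eqP; rewrite eq_le g1 andbT -oppr_ge0 -gNE.
Qed.

End SupportingSets.

(** * Faces of convex hulls *)

Section FaceLattice.
Variable R : realType.

Lemma conv_hull_convex d (A : set 'rV[R]_d) : @convex_set R 'rV[R]_d (conv_hull A).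
Proof.
move=> x y l; rewrite !inE => xA yA B [Bc AB].
have Bl := Bc x y l; apply: set_mem; apply: Bl; rewrite inE; [exact: xA|exact: yA].
Qed.

Lemma sub_conv_hull d (A : set 'rV[R]_d) : A `<=` conv_hull A.
Proof. exact: sub_gen_smallest. Qed.

Lemma conv_hull_sub d (A B : set 'rV[R]_d) :
  @convex_set R 'rV[R]_d B -> A `<=` B -> conv_hull A `<=` B.
Proof. exact: smallest_sub. Qed.

Lemma conv_hullS d (A B : set 'rV[R]_d) : A `<=` B -> conv_hull A `<=` conv_hull B.
Proof.
move=> AB; apply: conv_hull_sub; first exact: conv_hull_convex.
exact: subset_trans AB (@sub_conv_hull _ _).
Qed.

Lemma affine_value_conv d (w : 'rV[R]_d.+1) (x y : 'rV[R]_d) (l : {i01 R}) :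
  affine_value w (conv l (x : convex_lmodType 'rV[R]_d) y)
    = l%:num * affine_value w x + (1 - l%:num) * affine_value w y.
Proof.
rewrite -[conv _ _ _]/(l%:num *: x + (1 - l%:num) *: y) /affine_value.
rewrite !(dot_productC w) -!dot_productZl -dot_productDl.
congr (dot_product _ _); apply/rowP => j.
rewrite [RHS]mxE [X in _ = X + _]mxE [X in _ = _ + X]mxE.
case: (unliftP 0 j) => [j'|] ->; last by rewrite !row_mx1_0; ring.
by rewrite !row_mx1_lift !mxE.
Qed.

Lemma affine_value_dot d (w : 'rV[R]_d.+1) (x : 'rV[R]_d) :
  affine_value w x = w 0 0 + dot_product (\row_j w 0 (lift 0 j)) x.
Proof.
rewrite /affine_value /dot_product big_ord_recl row_mx1_0 mulr1; congr (_ + _).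
by apply: eq_bigr => j _; rewrite row_mx1_lift mxE.
Qed.

(** Every face has this form, where S is the set of indices of the points on it. *)
Definition span_hull d n (p : 'I_n -> 'rV[R]_d) (S : {set 'I_n}) : set 'rV[R]_d :=
  conv_hull (p @` [set i | i \in S]).

Section Supported.
Context (d n : nat) (p : 'I_n -> 'rV[R]_d) (S : {set 'I_n}) (w : 'rV[R]_d.+1).
Context (wP : forall i,
  if i \in S then affine_value w (p i) = 0 else 0 < affine_value w (p i)).

Lemma supported_ge0 x : conv_hull (range p) x -> 0 <= affine_value w x.
Proof.
apply: (@conv_hull_sub _ _ [set x | 0 <= affine_value w x]) => [y z l|_ [i _ <-] /=].
  rewrite !inE /= => y0 z0; rewrite affine_value_conv.
  by rewrite addr_ge0 // mulr_ge0 // subr_ge0.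
by have := wP i; case: ifP => _; [move=> ->|move=> /ltW].
Qed.

(** Points of the hull that are either strictly inside the half-space or in the hull
    of the points indexed by S form a convex set that contains all p i, so it is
    the whole hull; no explicit convex combinations are needed. *)
Lemma supported_hull :
  span_hull p S = conv_hull (range p) `&` [set x | affine_value w x = 0].
Proof.
apply/seteqP; split=> x.
  move=> xS; split; first by apply: conv_hullS xS => _ [i _ <-]; exists i.
  apply: (conv_hull_sub _ _ xS) => [y z l|_ [i /= iS <-]].
    by rewrite !inE /= => y0 z0; rewrite affine_value_conv y0 z0 !mulr0 addr0.
  by have := wP i; rewrite iS.
move=> [xP /= x0].
pose B : set 'rV[R]_d :=
  [set y | conv_hull (range p) y /\ (0 < affine_value w y \/ span_hull p S y)].
suff [_ [|//]] : B x by rewrite x0 ltxx.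
apply: (@conv_hull_sub _ (range p)) xP => [|_ [i _ <-]]; last first.
  split; first by apply: sub_conv_hull; exists i.
  have := wP i; case: ifPn => iS wi; [right|by left].
  by apply: sub_conv_hull; exists i.
apply/convex_setW => y z; rewrite !inE => -[yP yB] [zP zB] l l0 l1.
rewrite inE; split; first by apply: set_mem; apply: conv_hull_convex; rewrite inE.
have [y0 z0] := (supported_ge0 yP, supported_ge0 zP).
rewrite affine_value_conv; case: yB => [ypos|yS].
  by left; rewrite ltr_pwDl ?mulr_gt0 // mulr_ge0 // subr_ge0 ltW.
case: zB => [zpos|zS].
  by left; rewrite ltr_pwDr ?mulr_gt0 ?subr_gt0 // mulr_ge0 // ltW.
by right; apply: set_mem; apply: conv_hull_convex; rewrite inE.
Qed.

End Supported.

Lemma supporting_vertex d n (p : 'I_n -> 'rV[R]_d) S i :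
  supporting p S -> span_hull p S (p i) <-> i \in S.
Proof.
move=> [w wP]; rewrite (supported_hull wP); split=> [[_ /= wi]|iS].
  by have := wP i; case: ifP => //; rewrite wi ltxx.
by split; [apply: sub_conv_hull; exists i | have := wP i; rewrite iS].
Qed.

Lemma supporting_face d n (p : 'I_n -> 'rV[R]_d) S :
  supporting p S -> is_face (conv_hull (range p)) (span_hull p S).
Proof.
move=> [w wP]; pose c : 'rV[R]_d := \row_j w 0 (lift 0 j).
exists (- c), (w 0 0).
have cE x : dot_product (- c) x = - dot_product c x.
  by rewrite -scaleN1r dot_productZl mulN1r.
split=> [x /(supported_ge0 wP)|].
  by rewrite affine_value_dot => h; rewrite cE -subr_ge0 opprK.
rewrite (supported_hull wP); congr (_ `&` _); apply/seteqP; split=> x /=.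
  by rewrite affine_value_dot cE => /eqP; rewrite addr_eq0 => /eqP.
by rewrite affine_value_dot cE => <-; rewrite addNr.
Qed.

Lemma face_supporting d n (p : 'I_n -> 'rV[R]_d) F :
  is_face (conv_hull (range p)) F -> exists2 S, supporting p S & F = span_hull p S.
Proof.
move=> [c [b [cb ->]]].
pose w : 'rV[R]_d.+1 := row_mx b%:M (- c).
have wE x : affine_value w x = b - dot_product c x.
  rewrite affine_value_dot /w; congr (_ + _).
    have -> : (0 : 'I_d.+1) = lshift d (0 : 'I_1) by apply: val_inj.
    by rewrite (row_mxEl (b%:M : 'rV[R]_1)) mxE.
  rewrite -mulN1r -dot_productZl scaleN1r; congr (dot_product _ _).
  by apply/rowP => j; rewrite mxE -rshift1 (row_mxEr (b%:M : 'rV[R]_1)).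
pose S := [set i | affine_value w (p i) == 0]%SET.
have wP i : if i \in S then affine_value w (p i) = 0 else 0 < affine_value w (p i).
  rewrite inE; case: eqP => // /eqP wi; rewrite lt_neqAle eq_sym wi wE subr_ge0.
  by apply: cb; apply: sub_conv_hull; exists i.
exists S; first by exists w.
rewrite (supported_hull wP); congr (_ `&` _); apply/seteqP; split=> x /=; rewrite wE.
  by move=> ->; rewrite subrr.
by move=> /eqP; rewrite subr_eq0 => /eqP.
Qed.

Lemma span_hull_subset d n (p : 'I_n -> 'rV[R]_d) S T :
  supporting p S -> supporting p T ->
  span_hull p S `<=` span_hull p T <-> S \subset T.
Proof.
move=> sS sT; split=> [ST|/fintype.subsetP ST].
  by apply/fintype.subsetP => i /(supporting_vertex _ sS)/ST/(supporting_vertex _ sT).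
by apply: conv_hullS => _ [i /= iS <-]; exists i => //=; apply: ST.
Qed.

(** A face of one hull is sent to the hull of the points of the other
    configuration with the same indices. *)
Lemma alternating_combinatorially_equivalent d n (p q : 'I_n -> 'rV[R]_d) :
  (d < n)%N -> alternating_order_type p -> alternating_order_type q ->
  combinatorially_equivalent (conv_hull (range p)) (conv_hull (range q)).
Proof.
move=> dn altp altq.
have pq S : supporting p S -> supporting q S by apply: supporting_alternating.
have qp S : supporting q S -> supporting p S by apply: supporting_alternating.
pose index (F : set 'rV[R]_d) : {set 'I_n} := [set i | `[< F (p i) >]]%SET.
have indexE S : supporting p S -> index (span_hull p S) = S.
  move=> sS; apply/setP => i; rewrite inE.
  by apply/asboolP/idP => /(supporting_vertex _ sS).
exists (fun F => span_hull q (index F)); last first.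
  move=> _ _ /face_supporting [S sS ->] /face_supporting [T sT ->].
  by rewrite !indexE // !span_hull_subset //; apply: pq.
split.
- move=> _ /= /face_supporting [S sS ->]; rewrite indexE //.
  by apply: supporting_face; apply: pq.
- move=> F G; rewrite !inE => /face_supporting [S sS ->] /face_supporting [T sT ->].
  rewrite !indexE // => E; suff -> : S = T by [].
  apply/setP => i; apply/idP/idP.
    move=> /(supporting_vertex _ (pq _ sS)); rewrite E.
    exact: (supporting_vertex _ (pq _ sT)).1.
  move=> /(supporting_vertex _ (pq _ sT)); rewrite -E.
  exact: (supporting_vertex _ (pq _ sS)).1.
- move=> _ /= /face_supporting [S sS ->]; exists (span_hull p S).
    by apply: supporting_face; apply: qp.
  by rewrite indexE //; apply: qp.
Qed.

Lemma moment_curve_alternating d n (t : 'I_n -> R) :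
  {homo t : i j / (i < j)%N >-> i < j} ->
  alternating_order_type (fun i => moment_curve d (t i)).
Proof.
move=> th; exists 1; first by left.
move=> i ih; rewrite mul1r /order_type gtr0_sg //.
have -> : \matrix_(k < d.+1) (row_mx 1 (moment_curve d (t (i k))) : 'rV[R]_d.+1)
    = (Vandermonde d.+1 (\row_k t (i k)))^T.
  apply/matrixP => a b; rewrite [LHS]mxE.
  have -> : (Vandermonde d.+1 (\row_k t (i k)))^T a b = t (i a) ^+ b by rewrite !mxE.
  case: (unliftP 0 b) => [b'|] ->; first by rewrite row_mx1_lift mxE.
  by rewrite row_mx1_0.
rewrite det_tr det_Vandermonde; apply: prodr_gt0 => a _; apply: prodr_gt0 => b ab.
by rewrite !mxE subr_gt0; apply: th; apply: ih.
Qed.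

End FaceLattice.

(** In odd dimension one extra point is constructed, to be used as the centre of
    the inversion. *)
Lemma exists_rational_alternating (R : realType) (d n : nat) :
  (2 <= d)%N -> (d.+1 <= n)%N ->
  exists p : 'I_n -> 'rV[R]_d,
    (forall i j, rational (euclidean_dist (p i) (p j))) /\ alternating_order_type p.
Proof.
move=> d2 dn; have [dodd|deven] := boolP (odd d).
  have m0 : (0 < uphalf d)%N by lia.
  have mE : (uphalf d).*2 = d.+1 by lia.
  have [q [qQ alt [rho qrho]]] := exists_even_configuration R n.+1 m0.
  move: q qQ alt qrho; rewrite mE => q qQ alt qrho.
  exact: contraction dn qQ alt qrho.
have m0 : (0 < d./2)%N by lia.
have mE : (d./2).*2 = d by lia.
have [q [qQ alt _]] := exists_even_configuration R n m0.
by move: q qQ alt; rewrite mE => q qQ alt; exists q.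
Qed.

Theorem theorem1p6 (R : realType) (d n : nat) (hd : (2 <= d)%N) (hn : (d.+1 <= n)%N) :
  exists p : 'I_n -> 'rV[R]_d,
    [/\ forall i j : 'I_n, euclidean_dist (p i) (p j) \is a Num.int,
        alternating_order_type p
      & realizes_cyclic n (conv_hull (range p))].
Proof.
have [p [pQ altp]] := exists_rational_alternating R hd hn.
have [c c0 cP] := @rational_common_denominator R _
  (fun ij : 'I_n * 'I_n => euclidean_dist (p ij.1) (p ij.2)) (fun ij => pQ ij.1 ij.2).
have c0' : 0 < (c%:R : R) by rewrite ltr0n.
pose q i := c%:R *: p i.
have altq : alternating_order_type q.
  case: altp => e e1 altp; exists e => // i ih; rewrite -(altp i ih); congr (_ * _).
  rewrite -(@order_type_scale_columns _ _ _ p (const_mx c%:R)) => [|j]; last by rewrite mxE.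
  rewrite /order_type; congr (Num.sg (\det _)); apply/row_matrixP => k; rewrite !rowK.
  by rewrite diag_const_mx mul_mx_scalar.
exists q; split=> //.
  by move=> i j; rewrite euclidean_distZ ?ler0n //; apply: (cP (i, j)).
split.
  by exists (range q) => //; apply: finite_image; apply: finite_finset.
move=> t th; apply: alternating_combinatorially_equivalent => //.
exact: moment_curve_alternating.
Qed.
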